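(* There is an uncountable family $\mathcal F$ of pairwise non-homeomorphic smooth fans such that each member $X\in\mathcal F$ admits a transitive homeomorphism.
   Context: A continuum is a non-empty compact connected metric space; a subcontinuum is a subspace of a continuum which is itself a continuum. A continuum $X$ is unicoherent if for any subcontinua $A,B$ of $X$ with $X=A\cup B$ the set $A\cap B$ is connected; it is hereditarily unicoherent if each of its subcontinua is unicoherent. A dendroid is an arcwise connected, hereditarily unicoherent continuum. An arc is a space homeomorphic to $[0,1]$. A simple triod is a space homeomorphic to $([-1,1]\times\{0\})\cup(\{0\}\times[0,1])$; its top is the point corresponding to $(0,0)$. A ramification point of a dendroid $X$ is a point that is the top of some simple triod contained in $X$. A fan is a dendroid with at most one ramification point $v$, called the top of the fan (if it exists). For points $x\ne y$ of a fan $X$, $A[x,y]$ denotes the (unique) arc in $X$ with end-points $x$ and $y$, and $A[x,x]=\{x\}$. A fan $X$ with top $v$ is smooth if for every $x\in X$ and every sequence $(x_n)$ in $X$ with $\lim_{n\to\infty}x_n=x$ one has $\lim_{n\to\infty}A[v,x_n]=A[v,x]$ with respect to the Hausdorff metric. A function $f:X\to X$ on a compact metric space is transitive if for all non-empty open sets $U,V\subseteq X$ there is a non-negative integer $n$ with $f^n(U)\cap V\neq\emptyset$. A compact metric space $X$ admits a transitive homeomorphism if there is a homeomorphism $f:X\to X$ that is transitive. *)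

(* Defs.v *)
From mathcomp Require Import all_boot all_order all_algebra.
From mathcomp Require Import all_classical all_reals all_analysis.

Set Implicit Arguments.
Unset Strict Implicit.
Unset Printing Implicit Defensive.

Import Order.TTheory GRing.Theory Num.Theory.
Import numFieldNormedType.Exports.

Local Open Scope classical_set_scope.
Local Open Scope ring_scope.

(* [f] restricts to a homeomorphism between the subspaces [A] and [B]; the
   values of [f] outside [A] and of [g] outside [B] are irrelevant. *)
Definition homeomorphism {T U : topologicalType} (A : set T) (B : set U)
    (f : T -> U) : Prop :=
  [/\ set_bij A B f,
      {within A, continuous f} &
      exists g : U -> T,
        {within B, continuous g} /\ (forall x, A x -> g (f x) = x)].

Definition homeomorphic {T U : topologicalType} (A : set T) (B : set U) : Prop :=
  exists f : T -> U, homeomorphism A B f.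

Section Continua.
Context {R : realType} {X : metricType R}.
Implicit Types (A B C S : set X) (x y v : X).

Definition continuum C : Prop := [/\ C !=set0, compact C & connected C].

Definition subcontinuum C A : Prop := A `<=` C /\ continuum A.

Definition unicoherent C : Prop :=
  forall A B, subcontinuum C A -> subcontinuum C B ->
    C = A `|` B -> connected (A `&` B).

Definition hereditarily_unicoherent C : Prop :=
  forall A, subcontinuum C A -> unicoherent A.

Definition arc_from_to x y A : Prop :=
  exists f : R -> X,
    [/\ homeomorphism (`[0 : R, 1]%classic : set R) A f, f 0 = x & f 1 = y].

Definition arcwise_connected C : Prop :=
  forall x y, C x -> C y -> x <> y ->
    exists A, A `<=` C /\ arc_from_to x y A.

Definition standard_triod : set (R * R) :=
  (`[-1, 1]%classic `*` [set 0]) `|` ([set 0] `*` `[0, 1]%classic).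

Definition simple_triod_with_top v S : Prop :=
  exists f : R * R -> X, homeomorphism standard_triod S f /\ f (0, 0) = v.

Definition ramification_point v : Prop :=
  exists S, simple_triod_with_top v S.

(* The arc A[x,y]; a distinguished choice among the arcs from [x] to [y], of
   which there is exactly one when [X] is a dendroid and [x <> y]. *)
Definition the_arc x y : set X :=
  if x == y then [set x] else xget set0 [set A | arc_from_to x y A].

Definition neighborhood_of A (r : R) : set X := \bigcup_(a in A) ball a r.

(* The Hausdorff metric on non-empty compact subsets; for such [A] and [B] the
   infimum is over a non-empty set. *)
Definition hausdorff_dist A B : R :=
  inf [set r : R | [/\ 0 < r, A `<=` neighborhood_of B r
                            & B `<=` neighborhood_of A r]].

Definition transitive_map (f : X -> X) : Prop :=
  forall U V : set X, open U -> open V -> U !=set0 -> V !=set0 ->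
    exists n : nat, (iter n f @` U) `&` V !=set0.

End Continua.

Definition dendroid {R : realType} (X : metricType R) : Prop :=
  [/\ continuum [set: X], arcwise_connected [set: X]
    & hereditarily_unicoherent [set: X]].

Definition fan {R : realType} (X : metricType R) : Prop :=
  dendroid X /\
  (forall v w : X, ramification_point v -> ramification_point w -> v = w).

Definition top_of_fan {R : realType} {X : metricType R} (v : X) : Prop :=
  fan X /\ ramification_point v.

(* Smoothness refers to the top, so a fan without ramification point (an arc or
   a point) is not counted as smooth. *)
Definition smooth_fan {R : realType} (X : metricType R) : Prop :=
  exists v : X, top_of_fan v /\
    forall (x : X) (u : nat -> X), u @ \oo --> x ->
      hausdorff_dist (the_arc v (u n)) (the_arc v x) @[n --> \oo] --> (0 : R).

Definition admits_transitive_homeomorphism {R : realType} (X : metricType R)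
    : Prop :=
  exists f : X -> X, homeomorphism [set: X] [set: X] f /\ transitive_map f.

(* Main.v *)
Require Import Defs.
From HB Require Import structures.
From mathcomp Require Import all_boot all_order all_algebra.
From mathcomp Require Import all_classical all_reals all_analysis.
From mathcomp Require Import ring lra zify.

(** The members of the family are planar cones [(y * c, y)], with [c] in a
    Cantor set of slopes.  Slopes code the bi-infinite words over the one-point
    compactification of a countable alphabet, and the leg of [w] has height
    [h (w 0)].  Heights are only continuous in [w 0], so several constant words
    may share one slope: their legs of different heights are then glued.
    The map sending height ratio [t] on the leg of [w] to the ratio
    [m t / (1 - t + m t)] on the leg of the shifted word, with [m] a continuous
    function of [w 0], is a homeomorphism as soon as [m = 1] on letters that take
    part in a gluing, and it is transitive when the values of [m] generate a dense
    multiplicative semigroup of the positive reals: a long enough block of letters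
    joins any two cylinders and corrects the height at will.
    The end points accumulate on a leg exactly at the heights of the words glued
    there.  For a set [S] of naturals, gluing [n + 2] letters for each [n] in [S]
    makes the numbers of such accumulation points determine [S], and these numbers
    are topological invariants because a fan has only one ramification point. *)

Set Implicit Arguments.
Unset Strict Implicit.
Unset Printing Implicit Defensive.

Import Order.TTheory GRing.Theory Num.Theory.
Import numFieldNormedType.Exports.

Local Open Scope classical_set_scope.
Local Open Scope ring_scope.

(** Gluing has to respect the dynamics. Only constant words are glued because the shift fixes them,
    so that the identification of their slopes is shift-invariant. A point of a glued leg has a
    different height ratio for each word on it, and multiplying [t / (1 - t)] by [m] commutes with a
    rescaling of [t] only for [m = 1]; the map is therefore the identity on such legs, and all
    motion in height comes from letters that are never glued. A nonconstant word has a slope of its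
    own, so the top of its leg is an end point. Every word is a limit of nonconstant ones, hence the
    tops of all words are limits of end points, even those lying strictly inside a glued leg;
    letters glued together have different heights, so these limits are distinct and can be counted.
    An unglued leg carries exactly one of them, which is why block sizes start at 2. Infinitely many
    rates and block sizes coexist with compactness because heights and rates both tend to 1 at the
    point at infinity of the alphabet. *)

(** * Continuity, homeomorphisms and quotients on compact sets *)

Lemma preimage_closed_within (T U : topologicalType) (A : set T) (f : T -> U) :
  (forall D, closed D -> closed (A `&` f @^-1` D)) -> {within A, continuous f}.
Proof.
move=> fcl; apply/continuous_closedP => D cD; apply/closed_subspaceP.
by exists (A `&` f @^-1` D); [exact: fcl | rewrite setIAC setIid setIC].
Qed.

Lemma within_preimage_compact (T U : topologicalType) (A : set T) (f : T -> U)
    (D : set U) :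
  compact A -> {within A, continuous f} -> closed D -> compact (A `&` f @^-1` D).
Proof.
move=> cA cf cD.
have /closed_subspaceP[V cV VA] : closed (f @^-1` D : set (subspace A)).
  by move: cf => /continuous_closedP; exact.
by rewrite setIC -VA setIC; exact: (compact_closedI cA cV).
Qed.

Lemma compact_homeomorphism (T U : topologicalType) (t0 : T)
    (A : set T) (f : T -> U) :
  hausdorff_space U -> compact A -> {within A, continuous f} ->
  (forall x y, A x -> A y -> f x = f y -> x = y) ->
  homeomorphism A (f @` A) f.
Proof.
move=> hU cA cf fI; split => //.
  split => [x Ax|x y /set_mem Ax /set_mem Ay|//]; first exact: imageP.
  exact: fI.
pose g u := xget t0 [set x | A x /\ f x = u].
have gK x : A x -> g (f x) = x.
  move=> Ax; rewrite /g; case: xgetP => [y _ [Ay /fI]|/(_ x)]; first exact.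
  by case.
exists g; split; last exact: gK.
apply: preimage_closed_within => D cD.
rewrite (_ : _ `&` _ = f @` (A `&` D)); last first.
  apply/seteqP; split => [u [[x Ax <-] /=]|u [x [Ax Dx] <-]] /=.
    by rewrite gK // => Dx; exists x.
  by rewrite gK //; split => //; exists x.
apply: compact_closed => //; apply: continuous_compact; last exact: (compact_closedI cA cD).
by apply: continuous_subspaceW cf => x [].
Qed.

Section CompactQuotient.
Variables (Z X Y : topologicalType) (E : set Z) (p : Z -> X).
Hypotheses (hX : hausdorff_space X) (cE : compact E).
Hypotheses (cp : {within E, continuous p}) (sp : forall x, exists2 z, E z & p z = x).

(** A continuous map from a compact set onto a Hausdorff space is closed, hence a quotient map. This
    is how maps on pairs of a word and a height ratio will descend to the fan. *)
Lemma compact_quotient_continuous (g : X -> Y) :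
  {within E, continuous (g \o p)} -> continuous g.
Proof.
move=> cg; apply/continuous_closedP => D cD.
rewrite (_ : g @^-1` D = p @` (E `&` (g \o p) @^-1` D)); last first.
  apply/seteqP; split => [x /= Dx|x [z [Ez Dz] <-] //].
  by have [z Ez zx] := sp x; exists z => //; split => //=; rewrite zx.
apply: compact_closed => //; apply: continuous_compact.
  by apply: continuous_subspaceW cp => x [].
exact: within_preimage_compact.
Qed.

Lemma compact_quotient_factor (G : Z -> Y) : {within E, continuous G} ->
  (forall z z', E z -> E z' -> p z = p z' -> G z = G z') ->
  exists2 g : X -> Y, continuous g & forall z, E z -> g (p z) = G z.
Proof.
move=> cG GE; have /choice[s sE] x : exists z, E z /\ p z = x.
  by have [z] := sp x; exists z.
have gE z : E z -> G (s (p z)) = G z.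
  by move=> Ez; have [? ?] := sE (p z); exact: GE.
exists (G \o s) => //; apply: compact_quotient_continuous.
by apply: (@subspace_eq_continuous _ _ _ G) cG => z /set_mem Ez; exact/esym/gE.
Qed.

End CompactQuotient.

Lemma within_continuous_comp (T U V : topologicalType) (A : set T) (B : set U)
    (f : T -> U) (g : U -> V) :
  {within A, continuous f} -> {within B, continuous g} ->
  (forall t, A t -> B (f t)) -> {within A, continuous (g \o f)}.
Proof.
move=> /subspace_continuousP cf /subspace_continuousP cg AB.
apply/subspace_continuousP => t At D gD.
have BD := cg _ (AB _ At) _ gD; have := cf _ At _ BD.
rewrite /nbhs /= /within /=; apply: filterS => s fD As.
by apply: fD => //; exact: AB.
Qed.

(** * Spaces with l1 coordinates *)

Section L1Coordinates.
Context {R : realType} {X : metricType R} {cx cy : X -> R}.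
Hypothesis l1_dist : forall p q, mdist p q = `|cx p - cx q| + `|cy p - cy q|.

Lemma l1_inj p q : cx p = cx q -> cy p = cy q -> p = q.
Proof.
move=> pqx pqy; apply: (@mdist_positivity R X).
by rewrite l1_dist pqx pqy !subrr normr0 addr0.
Qed.

Lemma l1_cvg (T : Type) (F : set_system T) (f : T -> X) p : Filter F ->
  cx (f t) @[t --> F] --> cx p -> cy (f t) @[t --> F] --> cy p -> f @ F --> p.
Proof.
move=> FF /cvgrPdist_lt fx /cvgrPdist_lt fy; apply/cvg_ballP => e e0.
have e20 : 0 < e / 2 by rewrite divr_gt0.
near=> t; rewrite ballEmdist /= l1_dist [e]splitr ltrD //.
  by near: t; exact: fx.
by near: t; exact: fy.
Unshelve. all: by end_near. Qed.

Lemma l1_continuous (T : topologicalType) (f : T -> X) :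
  continuous (fun t => cx (f t)) -> continuous (fun t => cy (f t)) -> continuous f.
Proof. by move=> fx fy t; apply: l1_cvg; [exact: fx | exact: fy]. Qed.

Lemma l1_cx_continuous : continuous cx.
Proof.
move=> p; apply/cvgrPdist_lt => e e0; apply/nbhs_ballP; exists e => //= q.
by rewrite ballEmdist /= l1_dist; apply: le_lt_trans; rewrite lerDl.
Qed.

Lemma l1_cy_continuous : continuous cy.
Proof.
move=> p; apply/cvgrPdist_lt => e e0; apply/nbhs_ballP; exists e => //= q.
by rewrite ballEmdist /= l1_dist; apply: le_lt_trans; rewrite lerDr.
Qed.

End L1Coordinates.

(* [X] sits in the upper half plane through the coordinates [cx, cy], carries
   the l1 metric, and is star-shaped about the origin [o]; by [chart_gap] the
   slopes omit a dense set, so that a connected set missing [o] has one slope. *)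
Record star_chart (R : realType) (X : metricType R) (cx cy : X -> R) (o : X)
    : Prop := StarChart {
  chart_dist : forall p q, mdist p q = `|cx p - cx q| + `|cy p - cy q| ;
  chart_compact : compact [set: X] ;
  chart_cx0 : cx o = 0 ;
  chart_cy0 : cy o = 0 ;
  chart_ge0 : forall p, 0 <= cy p ;
  chart_eq0 : forall p, cy p = 0 -> cx p = 0 ;
  chart_star : forall p s, 0 <= s <= 1 ->
    exists q, cx q = s * cx p /\ cy q = s * cy p ;
  chart_gap : forall a b : R, a < b ->
    exists2 r, a < r < b & forall p, 0 < cy p -> cx p != r * cy p ;
  chart_three : exists p q r,
    [/\ cx p * cy q != cx q * cy p, cx q * cy r != cx r * cy q &
        cx p * cy r != cx r * cy p] }.

(** * Connected sets in a star-shaped chart *)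

Section StarChartTheory.
Context {R : realType} {X : metricType R} {cx cy : X -> R} {o : X}.
Hypothesis XC : star_chart cx cy o.

Let cy_ge0 := chart_ge0 XC.

Let chart_inj := l1_inj (chart_dist XC).

Lemma chart_oP p : cy p = 0 -> p = o.
Proof.
move=> p0; apply: chart_inj; last by rewrite p0 (chart_cy0 XC).
by rewrite (chart_cx0 XC) (chart_eq0 XC).
Qed.

Lemma chart_gt0 p : p <> o -> 0 < cy p.
Proof.
by move=> po; rewrite lt_neqAle cy_ge0 andbT eq_sym; apply/eqP => /chart_oP.
Qed.

(** Allows paths in [X] to be given by real formulas: the coordinates determine the point, and the
    l1 metric turns continuity of both coordinates into continuity in [X]. Outside [A] any value
    will do. *)
Lemma chart_lift (T : topologicalType) (A : set T) (u v : T -> R) :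
  {within A, continuous u} -> {within A, continuous v} ->
  (forall t, A t -> exists p, cx p = u t /\ cy p = v t) ->
  exists2 f : T -> X, {within A, continuous f} &
    forall t, A t -> cx (f t) = u t /\ cy (f t) = v t.
Proof.
move=> cu cv uv.
have /choice[f fE] t : exists p, A t -> cx p = u t /\ cy p = v t.
  by have [/uv[p ?]|nA] := pselect (A t); [exists p | exists o].
exists f => //; apply/subspace_continuousP => t At.
have [fx fy] := fE _ At.
apply: (l1_cvg (chart_dist XC)); [rewrite fx|rewrite fy].
- move/subspace_continuousP: cu => /(_ t At); apply: cvg_trans.
  by apply: near_eq_cvg; rewrite near_withinE; near=> s => As; have [] := fE _ As.
- move/subspace_continuousP: cv => /(_ t At); apply: cvg_trans.
  by apply: near_eq_cvg; rewrite near_withinE; near=> s => As; have [] := fE _ As.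
Unshelve. all: by end_near. Qed.

(** The segment from [x] up to [y] when both lie on one leg. Slopes are compared by cross products
    so that the origin, which has no slope, may be the lower end. *)
Definition leg_span (x y : X) : set X :=
  [set p | cx p * cy y = cx y * cy p /\ cy x <= cy p <= cy y].

Lemma span_connected x y : cy x <= cy y -> connected (leg_span x y).
Proof.
move=> xy.
have [f cf fE] : exists2 f : R -> X, {within `[cy x, cy y], continuous f} &
    forall t, `[cy x, cy y]%classic t -> cx (f t) = t * (cx y / cy y) /\ cy (f t) = t.
  apply: chart_lift.
  - by apply: continuous_subspaceT => t; exact: mulrr_continuous.
  - by apply: continuous_subspaceT => t.
  move=> t; rewrite /= in_itv /= => /andP[xt ty].
  have t0 : 0 <= t by exact: le_trans xt.
  have [y0|y0] := eqVneq (cy y) 0.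
    exists o; rewrite (chart_cx0 XC) (chart_cy0 XC) y0 invr0 !mulr0.
    by split => //; apply/eqP; rewrite eq_le t0 -y0 ty.
  have yp : 0 < cy y by rewrite lt_neqAle eq_sym y0 cy_ge0.
  have [|q [qx qy]] := chart_star XC y (s := t / cy y).
    by rewrite divr_ge0 // ler_pdivrMr // mul1r.
  by exists q; rewrite qx qy; split; field.
rewrite (_ : leg_span x y = f @` `[cy x, cy y]); last first.
  apply/seteqP; split => [p [pl pb]|_ [t tb <-]]; last first.
    have [fx fy] := fE _ tb; rewrite /leg_span /= fx fy; split => //.
    have [y0|y0] := eqVneq (cy y) 0; last by field.
    by rewrite y0 (chart_eq0 XC y0) invr0 !mulr0 mul0r.
  have pb' : `[cy x, cy y]%classic (cy p) by rewrite /= in_itv.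
  exists (cy p) => //; have [fx fy] := fE _ pb'.
  apply: chart_inj => //; rewrite fx.
  have [y0|y0] := eqVneq (cy y) 0.
    rewrite y0 invr0 !mulr0 (chart_eq0 XC) //.
    by apply/eqP; rewrite eq_le cy_ge0 andbT -y0; case/andP: pb.
  by rewrite mulrA [_ * cx y]mulrC -pl mulfK.
by apply: connected_continuous_connected cf; exact: segment_connected.
Qed.

Lemma slope_within_continuous (C : set X) : (forall p, C p -> 0 < cy p) ->
  {within C, continuous (fun p => cx p / cy p)}.
Proof.
move=> C0; apply: continuous_in_subspaceT => p /set_mem /C0 p0.
apply: cvgM; first exact: (l1_cx_continuous (chart_dist XC)).
by apply: cvgV; [rewrite gt_eqF | exact: (l1_cy_continuous (chart_dist XC))].
Qed.

Lemma connected_leg (C : set X) x y : connected C -> ~ C o -> C x -> C y ->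
  cx x * cy y = cx y * cy x.
Proof.
move=> cC Co; have C0 p : C p -> 0 < cy p.
  by move=> Cp; apply: chart_gt0 => po; apply: Co; rewrite -po.
wlog : x y / cx x / cy x <= cx y / cy y.
  move=> W Cx Cy; have [xy|xy] := leP (cx x / cy x) (cx y / cy y).
    exact: W.
  by apply/esym/W => //; exact: ltW.
move=> xy Cx Cy; have [x0 y0] := (C0 _ Cx, C0 _ Cy).
move: xy; rewrite le_eqVlt => /orP[|xy].
  by rewrite eqr_div ?lt0r_neq0 // => /eqP.
have [r /andP[xr ry] rN] := chart_gap XC xy.
have /connected_intervalP/(_ (cx x / cy x) (cx y / cy y)) :=
  connected_continuous_connected cC (slope_within_continuous C0).
move=> /(_ (imageP _ Cx) (imageP _ Cy) r).
rewrite (ltW xr) (ltW ry) => /(_ isT)[p Cp pr].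
by have := rN _ (C0 _ Cp); rewrite -pr mulfVK ?eqxx // gt_eqF // C0.
Qed.

Lemma span_sub_avoiding (C : set X) x y : connected C -> ~ C o -> C x -> C y ->
  leg_span x y `<=` C.
Proof.
move=> cC NCo Cx Cy z [zy xzy].
have y0 : 0 < cy y by apply: chart_gt0 => yo; apply: NCo; rewrite -yo.
have /connected_intervalP/(_ (cy x) (cy y)) := connected_continuous_connected
  cC (continuous_subspaceT (l1_cy_continuous (chart_dist XC))).
move=> /(_ (imageP _ Cx) (imageP _ Cy) (cy z) xzy) [p Cp pz].
suff <- : p = z by [].
apply: chart_inj => //; apply: (mulIf (lt0r_neq0 y0)).
by rewrite zy -pz; exact: (connected_leg cC).
Qed.

(** When [C] contains the origin it can spread over many legs, and the slope argument fails. If [C]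
    missed a point [z] of the segment, a thin sector around this leg, cut off at the height of [z],
    would contain a part of [C] that is both open and closed in [C], holds [y] and misses the
    origin. *)
Lemma span_sub (C : set X) x y : closed C -> connected C -> C x -> C y ->
  cx x * cy y = cx y * cy x -> leg_span x y `<=` C.
Proof.
move=> clC cC Cx Cy xy z [zy /andP[xz zy']].
have [->//|zNx] := pselect (z = x).
have [->//|zNy] := pselect (z = y).
have x_lt_z : cy x < cy z.
  rewrite lt_neqAle xz andbT; apply/eqP => xzE; apply: zNx; apply: chart_inj => //.
  have [y0|y0] := eqVneq (cy y) 0.
    have z0 : cy z = 0 by apply/eqP; rewrite eq_le cy_ge0 andbT -y0.
    by rewrite !(chart_eq0 XC) // xzE.
  by apply: (mulIf y0); rewrite xy zy xzE.
have z0 : 0 < cy z by exact: le_lt_trans x_lt_z.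
have y0 : 0 < cy y by exact: lt_le_trans zy'.
have z_lt_y : cy z < cy y.
  rewrite lt_neqAle zy' andbT; apply/eqP => zyE; apply: zNy; apply: chart_inj => //.
  by apply: (mulIf (lt0r_neq0 y0)); rewrite zy zyE.
have [Co|NCo] := pselect (C o); last first.
  by apply: (span_sub_avoiding cC NCo Cx Cy); rewrite /leg_span /= xz zy'.
apply: contrapT => NCz.
have /nbhs_ballP[e /= e0 zeC] : nbhs z (~` C).
  by apply: open_nbhs_nbhs; split => //; exact: closed_openC.
(* With slopes within [d] of that of [z], the bottom edge of the sector lies in the ball of radius
   [e] about [z], which misses [C]. *)
have [d d0 dz] : exists2 d, 0 < d & d * cy z = e.
  by exists (e / cy z); rewrite ?divr_gt0 // mulfVK // gt_eqF.
pose s := cx z / cy z; have sz : s * cy z = cx z by rewrite mulfVK // gt_eqF.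
have [r1 /andP[sr1 r1s] r1N] : exists2 r, s - d < r < s & forall p, 0 < cy p -> cx p != r * cy p.
  by apply: (chart_gap XC); rewrite ltrBlDr ltrDl.
have [r2 /andP[sr2 r2s] r2N] : exists2 r, s < r < s + d & forall p, 0 < cy p -> cx p != r * cy p.
  by apply: (chart_gap XC); rewrite ltrDl.
pose U : set X := [set p | r1 * cy p < cx p] `&` [set p | cx p < r2 * cy p] `&`
  [set p | cy z < cy p].
pose D : set X := [set p | r1 * cy p <= cx p] `&` [set p | cx p <= r2 * cy p] `&`
  [set p | cy z <= cy p].
have cX := l1_cx_continuous (chart_dist XC); have cY := l1_cy_continuous (chart_dist XC).
have cM r : continuous (fun p => r * cy p).
  by move=> p; apply: cvgM; [exact: cvg_cst | exact: cY].
have oU : open U.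
  have lt_open (f g : X -> R) : continuous f -> continuous g -> open [set p | f p < g p].
    move=> cf cg; rewrite (_ : [set _ | _] = (g \- f) @^-1` [set t | 0 < t]).
      have /continuousP : continuous (g \- f).
        by move=> p; exact: (cvgB (cg p) (cf p)).
      by apply; exact: open_gt.
    by apply/seteqP; split => p /=; rewrite subr_gt0.
  by apply: openI; [apply: openI|]; apply: lt_open => // p; exact: cvg_cst.
have cD : closed D.
  have le_closed (f g : X -> R) : continuous f -> continuous g -> closed [set p | f p <= g p].
    move=> cf cg; rewrite (_ : [set _ | _] = (g \- f) @^-1` [set t | 0 <= t]).
      have /continuous_closedP : continuous (g \- f).
        by move=> p; exact: (cvgB (cg p) (cf p)).
      by apply; exact: closed_ge.
    by apply/seteqP; split => p /=; rewrite subr_ge0.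
  by apply: closedI; [apply: closedI|]; apply: le_closed => // p; exact: cvg_cst.
(* No point of [X] above the origin lies on the lateral edges, their slopes being omitted; no point
   of [C] lies on the bottom edge by the choice of [d]. *)
have UD : C `&` U = C `&` D.
  apply/seteqP; split => p [Cp [[/= p1 p2] p3]]; split => //.
    by split; [split|]; exact: ltW.
  have p0 : 0 < cy p by exact: lt_le_trans p3.
  have p1' : r1 * cy p < cx p by rewrite lt_neqAle p1 andbT eq_sym r1N.
  have p2' : cx p < r2 * cy p by rewrite lt_neqAle p2 andbT r2N.
  split => //=; rewrite lt_neqAle p3 andbT; apply/eqP => pz.
  apply: (zeC p) => //; rewrite ballEmdist /= (chart_dist XC) -pz subrr normr0 addr0.
  rewrite -dz pz ltr_norml -sz pz; apply/andP; split.
    by move: p2'; rewrite -(ltr_pM2r p0) in r2s; lra.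
  by move: p1'; rewrite -(ltr_pM2r p0) in sr1; lra.
have slope_y : s * cy y = cx y by rewrite /s mulrAC zy mulfK ?gt_eqF.
have Uy : (C `&` U) y.
  split => //; split => //; split => /=; rewrite -slope_y ltr_pM2r //.
have : C `&` U = C.
  apply: cC; [by exists y|by exists U|by exists D].
by move=> /seteqP[_ /(_ o Co)] [_ [_ /=]]; rewrite (chart_cy0 XC) ltNge ltW.
Qed.

End StarChartTheory.

(** * Hereditary unicoherence and arcs *)

Section StarChartDendroid.
Context {R : realType} {X : metricType R} {cx cy : X -> R} {o : X}.
Hypothesis XC : star_chart cx cy o.

Let cy_ge0 := chart_ge0 XC.
Local Notation span := (@leg_span R X cx cy).

Lemma span_origin_l x : span o x o.
Proof.
by rewrite /leg_span /= (chart_cx0 XC) (chart_cy0 XC) mul0r mulr0 lexx cy_ge0.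
Qed.

Lemma span_origin_r x : span o x x.
Proof. by split => //; rewrite (chart_cy0 XC) cy_ge0 lexx. Qed.

Lemma span_origin_connected x : connected (span o x).
Proof. by apply: (span_connected XC); rewrite (chart_cy0 XC). Qed.

Lemma chart_connected : connected [set: X].
Proof.
rewrite (_ : setT = \bigcup_(x in [set: X]) span o x).
  apply: bigcup_connected => [|x _]; last exact: span_origin_connected.
  by exists o => x _; exact: span_origin_l.
by apply/esym; apply/seteqP; split => // x _; exists x => //; exact: span_origin_r.
Qed.

(** The intersection is a union of segments issuing from one point, each contained in both sets by
    [span_sub]. That point is the origin if both sets contain it. Otherwise, up to exchanging the
    sets, [A] misses the origin, lies on a single leg, and any common point serves. *)
Lemma closed_connectedI (A B : set X) : closed A -> closed B ->
  connected A -> connected B -> connected (A `&` B).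
Proof.
wlog AB : A B / A o -> B o.
  move=> W; have [?|/not_implyP[? ?]] := pselect (A o -> B o); first exact: W.
  by move=> ? ? ? ?; rewrite setIC; apply: W.
move=> clA clB cA cB; have [Ao|NAo] := pselect (A o).
  rewrite (_ : A `&` B = \bigcup_(x in A `&` B) span o x).
    apply: bigcup_connected => [|x _]; last exact: span_origin_connected.
    by exists o => x _; exact: span_origin_l.
  apply/seteqP; split => x; first by exists x => //; exact: span_origin_r.
  move=> [y [Ay By] xy].
  have oy : cx o * cy y = cx y * cy o.
    by rewrite (chart_cx0 XC) (chart_cy0 XC) mul0r mulr0.
  by split; [apply: (span_sub XC clA cA Ao Ay oy) | apply: (span_sub XC clB cB (AB Ao) By oy)].
have [->|/set0P[x [Ax Bx]]] := eqVneq (A `&` B) set0; first exact: connected0.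
have leg y : A y -> cx x * cy y = cx y * cy x.
  by move=> Ay; exact: (connected_leg XC cA).
pose S y := if cy x <= cy y then span x y else span y x.
rewrite (_ : A `&` B = \bigcup_(y in A `&` B) S y).
  apply: bigcup_connected => [|y _].
    exists x => y [Ay By]; rewrite /S; case: ifPn => [xy|].
      by split; [exact: leg | rewrite lexx].
    by rewrite -ltNge => yx; split; rewrite // lexx ltW.
  rewrite /S; case: ifPn => [|]; first exact: (span_connected XC).
  by rewrite -ltNge => /ltW; exact: (span_connected XC).
apply/seteqP; split => y.
  move=> [Ay By]; exists y => //; rewrite /S; case: ifPn => [xy|].
    by split => //; rewrite lexx xy.
  rewrite -ltNge => yx; split; last by rewrite lexx ltW.
  exact/esym/leg.
move=> [z [Az Bz]]; rewrite /S; case: ifPn => _ yS.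
  by split; [apply: (span_sub XC clA cA Ax Az)|apply: (span_sub XC clB cB Bx Bz)] => //;
    exact: leg.
by split; [apply: (span_sub XC clA cA Az Ax)|apply: (span_sub XC clB cB Bz Bx)] => //;
  exact/esym/leg.
Qed.

(** On one leg the combination is a multiple, by a factor at most 1, of the higher of the two
    points, so star-shapedness applies. *)
Lemma combination_exists x y a b : cx x * cy y = cx y * cy x ->
  0 <= a -> 0 <= b -> a + b <= 1 ->
  exists p, cx p = a * cx x + b * cx y /\ cy p = a * cy x + b * cy y.
Proof.
wlog xy : x y a b / cy x <= cy y.
  move=> W l a0 b0 ab; have [xy|/ltW xy] := leP (cy x) (cy y); first exact: W.
  have [|p [px py]] := W y x b a xy (esym l) b0 a0; first by rewrite addrC.
  by exists p; rewrite px py addrC; split => //; rewrite addrC.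
move=> l a0 b0 ab; have [y0|y0] := eqVneq (cy y) 0.
  have x0 : cy x = 0 by apply/eqP; rewrite eq_le cy_ge0 andbT -y0.
  exists o; rewrite !(chart_eq0 XC x0, chart_eq0 XC y0) x0 y0 !mulr0 addr0.
  by rewrite (chart_cx0 XC) (chart_cy0 XC).
have yp : 0 < cy y by rewrite lt_neqAle eq_sym y0 cy_ge0.
have x0 := cy_ge0 x.
have [|p [px py]] := chart_star XC y (s := (a * cy x + b * cy y) / cy y).
  rewrite divr_ge0 ?addr_ge0 ?mulr_ge0 //= ler_pdivrMr // mul1r.
  have := mulr_ge0 a0 (ltac:(by rewrite subr_ge0) : 0 <= cy y - cy x).
  by have := mulr_ge0 (ltac:(by rewrite subr_ge0) : 0 <= 1 - (a + b)) (ltW yp); lra.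
exists p; rewrite px py; split; last by rewrite mulfVK.
apply: (mulIf y0); rewrite mulrAC mulfVK // !mulrDl -[RHS]/(_ + _).
by rewrite -[a * cx x * _]mulrA l; ring.
Qed.

Lemma lift_arc (u v : R -> R) (x y : X) :
  continuous u -> continuous v ->
  (forall t, 0 <= t <= 1 -> exists p, cx p = u t /\ cy p = v t) ->
  (forall s t, 0 <= s <= 1 -> 0 <= t <= 1 -> u s = u t -> v s = v t -> s = t) ->
  cx x = u 0 -> cy x = v 0 -> cx y = u 1 -> cy y = v 1 ->
  exists A, arc_from_to x y A.
Proof.
move=> cu cv uv inj x0 y0 x1 y1.
have [f cf fE] : exists2 f : R -> X, {within `[0, 1], continuous f} &
    forall t, `[0 : R, 1]%classic t -> cx (f t) = u t /\ cy (f t) = v t.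
  apply: (chart_lift XC) => [||t].
  - exact: continuous_subspaceT.
  - exact: continuous_subspaceT.
  by rewrite /= in_itv; exact: uv.
exists (f @` `[0, 1]), f; split.
- apply: (compact_homeomorphism 0) => //.
  + exact: metric_hausdorff.
  + exact: segment_compact.
  move=> s t s01 t01 fst; have [[su sv] [tu tv]] := (fE _ s01, fE _ t01).
  by apply: inj; move: s01 t01; rewrite /= ?in_itv // -?su -?tu -?sv -?tv fst.
- have [|fu fv] := fE 0; first by rewrite /= in_itv /= lexx ler01.
  by apply: (l1_inj (chart_dist XC)); rewrite ?fu ?fv.
- have [|fu fv] := fE 1; first by rewrite /= in_itv /= lexx ler01.
  by apply: (l1_inj (chart_dist XC)); rewrite ?fu ?fv.
Qed.

Lemma collinear_arc x y : x <> y -> cx x * cy y = cx y * cy x ->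
  exists A, arc_from_to x y A.
Proof.
move=> xy l.
apply: (lift_arc (u := fun t => (1 - t) * cx x + t * cx y)
                 (v := fun t => (1 - t) * cy x + t * cy y));
  rewrite ?subr0 ?subrr ?mul1r ?mul0r ?addr0 ?add0r //.
- by move=> t; apply: cvgD; apply: cvgM; try exact: cvg_cst;
    [apply: cvgB; [exact: cvg_cst|]|]; exact: cvg_id.
- by move=> t; apply: cvgD; apply: cvgM; try exact: cvg_cst;
    [apply: cvgB; [exact: cvg_cst|]|]; exact: cvg_id.
- move=> t /andP[t0 t1]; apply: combination_exists => //; first by rewrite subr_ge0.
  by rewrite subrK.
move=> s t _ _ eu ev; apply: contrapT => /eqP st; apply: xy.
have st0 : s - t != 0 by rewrite subr_eq0.
apply: (l1_inj (chart_dist XC)); apply: (mulfI st0); apply/eqP; rewrite -subr_eq0; apply/eqP.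
  transitivity (((1 - t) * cx x + t * cx y) - ((1 - s) * cx x + s * cx y)).
    by ring.
  by rewrite eu subrr.
transitivity (((1 - t) * cy x + t * cy y) - ((1 - s) * cy x + s * cy y)).
  by ring.
by rewrite ev subrr.
Qed.

Definition pos_part (t : R) := Num.max t 0.

Lemma pos_part_continuous (T : topologicalType) (u : T -> R) :
  continuous u -> continuous (fun t => pos_part (u t)).
Proof. by move=> cu t; apply: continuous_max; [exact: cu | exact: cvg_cst]. Qed.

Lemma pos_part_ge0 t : 0 <= pos_part t.
Proof. by rewrite le_max lexx orbT. Qed.

Lemma pos_part_id t : 0 <= t -> pos_part t = t.
Proof. by move=> t0; exact/max_idPl. Qed.

Lemma pos_part_eq0 t : t <= 0 -> pos_part t = 0.
Proof. by move=> t0; exact/max_idPr. Qed.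

(** For points on different legs the arc descends from [x] to the origin during the first half of
    the time and ascends to [y] during the second; positive parts put both halves into one
    formula. *)
Lemma bent_arc x y : cx x * cy y <> cx y * cy x -> exists A, arc_from_to x y A.
Proof.
move=> l.
have x0 : 0 < cy x.
  apply: (chart_gt0 XC) => xo; apply: l.
  by rewrite xo (chart_cx0 XC) (chart_cy0 XC) mul0r mulr0.
have y0 : 0 < cy y.
  apply: (chart_gt0 XC) => xo; apply: l.
  by rewrite xo (chart_cx0 XC) (chart_cy0 XC) mul0r mulr0.
have a_c : continuous (fun t : R => pos_part (1 - 2 * t)).
  apply: pos_part_continuous => t; apply: cvgB; first exact: cvg_cst.
  by apply: cvgM; [exact: cvg_cst|exact: cvg_id].
have b_c : continuous (fun t : R => pos_part (2 * t - 1)).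
  apply: pos_part_continuous => t; apply: cvgB; last exact: cvg_cst.
  by apply: cvgM; [exact: cvg_cst|exact: cvg_id].
have half t : (pos_part (2 * t - 1) = 0 /\ pos_part (1 - 2 * t) = 1 - 2 * t) \/
              (pos_part (2 * t - 1) = 2 * t - 1 /\ pos_part (1 - 2 * t) = 0).
  have [h|/ltW h] := leP (2 * t) 1; [left|right]; split.
  - by apply: pos_part_eq0; lra.
  - by apply: pos_part_id; lra.
  - by apply: pos_part_id; lra.
  - by apply: pos_part_eq0; lra.
have a0 : pos_part (1 - 2 * 0) = 1 by rewrite pos_part_id; lra.
have a1 : pos_part (1 - 2 * 1) = 0 by apply: pos_part_eq0; lra.
have b0 : pos_part (2 * 0 - 1) = 0 by apply: pos_part_eq0; lra.
have b1 : pos_part (2 * 1 - 1) = 1 by rewrite pos_part_id; lra.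
apply: (lift_arc (u := fun t => pos_part (1 - 2 * t) * cx x + pos_part (2 * t - 1) * cx y)
                 (v := fun t => pos_part (1 - 2 * t) * cy x + pos_part (2 * t - 1) * cy y)).
- by move=> t; apply: cvgD; apply: cvgM; try exact: cvg_cst; [exact: a_c|exact: b_c].
- by move=> t; apply: cvgD; apply: cvgM; try exact: cvg_cst; [exact: a_c|exact: b_c].
- move=> t /andP[t0 t1].
  have [[bt at_]|[bt at_]] := half t; rewrite bt at_.
    have [|p [px py]] := chart_star XC x (s := 1 - 2 * t).
      by have := pos_part_ge0 (1 - 2 * t); rewrite at_; lra.
    by exists p; rewrite px py !mul0r !addr0.
  have [|p [px py]] := chart_star XC y (s := 2 * t - 1).
    by have := pos_part_ge0 (2 * t - 1); rewrite bt; lra.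
  by exists p; rewrite px py !mul0r !add0r.
(* A point of the descending half can equal one of the ascending half only at the origin, the slopes
   being different, and then both times are one half. *)
- have key s t : pos_part (2 * s - 1) = 0 -> pos_part (2 * t - 1) = 2 * t - 1 ->
      pos_part (1 - 2 * s) = 1 - 2 * s -> pos_part (1 - 2 * t) = 0 ->
      (1 - 2 * s) * cx x = (2 * t - 1) * cx y -> (1 - 2 * s) * cy x = (2 * t - 1) * cy y ->
      s = t.
    move=> s0 t0 s1 t1 ex ey.
    have [s2|s2] := eqVneq (1 - 2 * s) 0.
      suff : 2 * t - 1 = 0 by lra.
      by apply: (mulIf (lt0r_neq0 y0)); rewrite -ey s2 !mul0r.
    exfalso; apply: l; apply: (mulfI s2).
    have [t2|t2] := eqVneq (2 * t - 1) 0.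
      move: ey; rewrite t2 mul0r => /eqP; rewrite mulf_eq0 (negbTE s2) /=.
      by rewrite gt_eqF.
    apply: (mulfI t2).
    rewrite [LHS](_ : _ = ((1 - 2 * s) * cx x) * ((2 * t - 1) * cy y)); last by ring.
    by rewrite ex -ey; ring.
  move=> s t s01 t01.
  have [[s0 s1]|[s0 s1]] := half s; have [[t0 t1]|[t0 t1]] := half t;
    rewrite s0 s1 t0 t1 !mul0r ?addr0 ?add0r => ex ey.
  + by move/(mulIf (lt0r_neq0 x0)): ey; lra.
  + exact: key.
  + by apply/esym/key.
  + by move/(mulIf (lt0r_neq0 y0)): ey; lra.
all: by rewrite ?(a0, a1, b0, b1) mul1r mul0r ?addr0 ?add0r.
Qed.

Lemma arc_exists (x y : X) : x <> y -> exists A, arc_from_to x y A.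
Proof.
move=> xy; have [l|l] := pselect (cx x * cy y = cx y * cy x).
  exact: collinear_arc.
exact: bent_arc.
Qed.

Lemma chart_dendroid : dendroid X.
Proof.
split.
- by split; [exists o|exact: chart_compact XC|exact: chart_connected].
- by move=> x y _ _ /arc_exists[A ?]; exists A.
move=> Y _ A B [_ [_ cA coA]] [_ [_ cB coB]] _.
by apply: closed_connectedI => //; apply: compact_closed => //; exact: metric_hausdorff.
Qed.

End StarChartDendroid.

(** Two arms that leave a point of a line in the same direction meet again: by the intermediate
    value theorem the arm reaching further attains the final value of the other. *)
Lemma disjoint_arms_opposite (R : realType) (g h : R -> R) (e : R) : 0 < e ->
  {within `[0, e], continuous g} -> {within `[0, e], continuous h} -> g 0 = h 0 ->
  (forall s t, 0 <= s <= e -> 0 <= t <= e -> g s = h t -> s = 0) ->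
  (forall s t, 0 <= s <= e -> 0 <= t <= e -> g s = h t -> t = 0) ->
  ~ (g 0 < g e /\ h 0 < h e).
Proof.
move=> e0 cg ch gh0 dg dh [ge he].
have e_in : 0 <= e <= e by rewrite lexx ltW.
have [gh|hg] := leP (g e) (h e).
- have [|c] := IVT (ltW e0) ch (v := g e).
    by rewrite ge_min le_max gh orbT -gh0 (ltW ge).
  rewrite in_itv /= => ce cg'; have := dg e c e_in ce (esym cg').
  by move/eqP; rewrite gt_eqF.
- have [|c] := IVT (ltW e0) cg (v := h e).
    by rewrite ge_min le_max (ltW hg) orbT gh0 (ltW he).
  rewrite in_itv /= => ce cg'; have := dh c e ce e_in cg'.
  by move/eqP; rewrite gt_eqF.
Qed.

(** * Arcs from the origin and smoothness *)

Section StarChartSmooth.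
Context {R : realType} {X : metricType R} {cx cy : X -> R} {o : X}.
Hypothesis XC : star_chart cx cy o.

Let cy_ge0 := chart_ge0 XC.
Local Notation span := (@leg_span R X cx cy).

(** The arc contains the segment by [span_sub]. Conversely, the parameters of the points of the
    segment form a connected set containing 0 and 1, hence all of the unit interval. *)
Lemma arc_from_origin x A : @arc_from_to R X o x A -> A = span o x.
Proof.
move=> [f [[[fA fI fS] cf [g [cg fK]]] f0 f1]].
have i0 : `[0 : R, 1]%classic 0 by rewrite /= in_itv /= lexx ler01.
have i1 : `[0 : R, 1]%classic 1 by rewrite /= in_itv /= lexx ler01.
have Ao : A o by rewrite -f0; exact: fA.
have Ax : A x by rewrite -f1; exact: fA.
have AE : A = f @` `[0, 1].
  by apply/seteqP; split => [a /fS//|_ [t t01 <-]]; exact: fA.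
have clA : closed A.
  rewrite AE; apply: compact_closed; first exact: metric_hausdorff.
  by apply: continuous_compact cf _; exact: segment_compact.
have coA : connected A.
  by rewrite AE; apply: connected_continuous_connected cf; exact: segment_connected.
have spanA : span o x `<=` A.
  by apply: (span_sub XC) => //; rewrite (chart_cx0 XC) (chart_cy0 XC) mul0r mulr0.
apply/seteqP; split => // a /fS[t t01 <-].
have : connected (g @` span o x).
  apply: connected_continuous_connected; first exact: (span_origin_connected XC).
  exact: continuous_subspaceW spanA cg.
move/connected_intervalP => /(_ 0 1).
move=> /(_ ltac:(rewrite -(fK 0 i0) f0; exact/imageP/(span_origin_l XC))).
move=> /(_ ltac:(rewrite -(fK 1 i1) f1; exact/imageP/(span_origin_r XC))).
move=> /(_ t); move: (t01); rewrite /= in_itv /= => t01' /(_ t01') [b sb bt].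
by have /fS[t' t'01 fb] := spanA _ sb; rewrite -bt -fb fK // fb.
Qed.

Lemma the_arc_origin x : the_arc (R := R) o x = span o x.
Proof.
rewrite /the_arc; case: eqP => [<-|ox].
  apply/seteqP; split => [_ ->|p [_ /andP[_]]]; first exact: (span_origin_l XC).
  rewrite (chart_cy0 XC) => p0; apply: (chart_oP XC).
  by apply/eqP; rewrite eq_le p0 cy_ge0.
case: xgetP => [A _ /arc_from_origin//|].
by have [A /[swap] /(_ A)] := arc_exists XC ox.
Qed.

(** The point at fraction [s] of one segment is matched with the point at fraction [s] of the other;
    their distance is [s] times that of [x] and [y]. *)
Lemma origin_arc_near x y r : mdist x y < r ->
  span o x `<=` neighborhood_of (span o y) r.
Proof.
move=> xy p [px /andP[_ pb]].
have r0 : 0 < r by apply: le_lt_trans xy; exact: mdist_ge0.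
have [x0|x0] := eqVneq (cy x) 0.
  exists o; first exact: (span_origin_l XC).
  rewrite (_ : p = o); first exact: ballxx.
  by apply: (chart_oP XC); apply/eqP; rewrite eq_le cy_ge0 -x0 pb.
have xp : 0 < cy x by rewrite lt_neqAle eq_sym x0 cy_ge0.
have [s [s01 px' py']] : exists s, [/\ 0 <= s <= 1, cx p = s * cx x & cy p = s * cy x].
  exists (cy p / cy x); split; last by rewrite mulfVK.
    by rewrite divr_ge0 // ler_pdivrMr // mul1r.
  by rewrite mulrAC [cy p * _]mulrC -px mulfK.
have [q [qx qy]] := chart_star XC y s01.
exists q.
  split; first by rewrite qx qy; ring.
  by rewrite (chart_cy0 XC) cy_ge0 qy ler_piMl //; case/andP: s01.
rewrite ballEmdist /= (chart_dist XC) qx qy px' py' -!mulrBr !normrM -mulrDr.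
have [s0 s1] := andP s01; apply: le_lt_trans xy.
rewrite (chart_dist XC) (ger0_norm s0) [in X in X + _]distrC [in X in _ + X]distrC.
by rewrite ler_piMl ?addr_ge0.
Qed.

Lemma chart_smooth x (u : nat -> X) : u @ \oo --> x ->
  hausdorff_dist (R := R) (the_arc (R := R) o (u n)) (the_arc (R := R) o x) @[n --> \oo] --> (0 : R).
Proof.
move=> /cvg_ballP ux; apply/cvgrPdist_lt => e e0.
have e2 : 0 < e / 2 by rewrite divr_gt0.
near=> n; rewrite !the_arc_origin sub0r normrN.
have d : mdist x (u n) < e / 2.
  by near: n; have := ux _ e2; apply: filterS => n; rewrite ballEmdist.
pose rs := [set r : R | [/\ 0 < r, span o (u n) `<=` neighborhood_of (span o x) r
  & span o x `<=` neighborhood_of (span o (u n)) r]].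
have lb : lbound rs 0 by move=> r [/ltW].
have he : rs (e / 2).
  by split => //; apply: origin_arc_near; rewrite // metric_sym.
rewrite ger0_norm; last by apply: lb_le_inf => //; exists (e / 2).
apply: (@le_lt_trans _ _ (e / 2)); last lra.
by apply: ge_inf he; exists 0.
Unshelve. all: by end_near. Qed.

End StarChartSmooth.

(** * The origin is the only ramification point *)

Section StarChartRamification.
Context {R : realType} {X : metricType R} {cx cy : X -> R} {o : X}.
Hypothesis XC : star_chart cx cy o.

Let cy_ge0 := chart_ge0 XC.

(** Away from the origin, short initial pieces of the three arms stay on the leg of [v], where the
    height is an injective coordinate. Two of them leave [v] in the same vertical direction, against
    [disjoint_arms_opposite]. *)
Lemma ramification_point_origin (v : X) : ramification_point (R := R) v -> v = o.
Proof.
move=> [S [f [[[fS fI _] cf _] f0]]]; apply: contrapT => vo.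
have v0 := chart_gt0 XC vo.
pose arm (d : R * R) (t : R) : R * R := (t * d.1, t * d.2).
pose D : set (R * R) := [set (1, 0)] `|` [set (-1, 0)] `|` [set (0, 1)].
have arm0 d : arm d 0 = (0, 0) by rewrite /arm !mul0r.
have armT d t : D d -> 0 <= t <= 1 -> standard_triod (R := R) (arm d t).
  move=> [[->|->]|->] /andP[t0 t1]; rewrite /standard_triod /arm /= !(mulr0, mulr1, mulrN1).
  - by left; split => //=; rewrite in_itv /= t1; apply/andP; split => //; lra.
  - by left; split => //=; rewrite in_itv /=; apply/andP; split => //; lra.
  - by right; split => //=; rewrite in_itv /= t0 t1.
have armI d d' s t : D d -> D d' -> d <> d' -> 0 <= s -> 0 <= t -> arm d s = arm d' t ->
    s = 0 /\ t = 0.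
  by move=> [[->|->]|->] [[->|->]|->] // _ s0 t0 [];
    rewrite !(mulr0, mulr1, mulrN1); split; lra.
have fI' p q : standard_triod (R := R) p -> standard_triod (R := R) q -> f p = f q -> p = q.
  by move=> *; apply: fI => //; exact/mem_set.
(* By injectivity at most one point [(a, b)] of the triod is sent to the origin. Its parameter on
   its arm is the l1 norm, and half of that stops every arm short of it. *)
have [e [/andP[e0 e1] eo]] : exists e : R, 0 < e <= 1 /\
    forall d t, D d -> 0 <= t <= e -> f (arm d t) <> o.
  have [[[a b] [zT zo]]|nz] := pselect (exists z, standard_triod (R := R) z /\ f z = o).
    have ab : 0 < `|a| + `|b| <= 1.
      apply/andP; split.
        rewrite lt_neqAle addr_ge0 // andbT eq_sym paddr_eq0 // !normr_eq0.
        apply/negP => /andP[/eqP a0 /eqP b0]; apply: vo.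
        by rewrite -f0 -zo a0 b0.
      case: zT => -[/=]; rewrite in_itv /=.
        by move=> ? ->; rewrite normr0 addr0 ler_norml.
      by move=> -> /andP[b0 b1]; rewrite normr0 add0r ger0_norm.
    exists ((`|a| + `|b|) / 2); split; first lra.
    move=> d t Dd /andP[t0 te] fo.
    have : arm d t = (a, b) by apply: fI'; rewrite ?fo ?zo //; apply: armT => //; lra.
    have n : `|(arm d t).1| + `|(arm d t).2| = t.
      by move: Dd => [[->|->]|->]; rewrite /arm /= ?(mulr0, mulr1, mulrN1, normrN, normr0, addr0, add0r) ger0_norm.
    by move=> E; move: n; rewrite E /=; lra.
  exists 1; split; first by rewrite ltr01 lexx.
  by move=> d t Dd t01 fo; apply: nz; exists (arm d t); split => //; exact: armT.
have arm_c d : continuous (arm d).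
  by move=> t; apply: (cvg_pair (G := nbhs (t * d.1)) (H := nbhs (t * d.2))); exact: mulrr_continuous.
have fa_c d : D d -> {within `[0, e], continuous (f \o arm d)}.
  move=> Dd; apply: within_continuous_comp cf _.
    exact: continuous_subspaceT.
  move=> t; rewrite /= in_itv /= => /andP[t0 te]; apply: armT => //.
  by rewrite t0 (le_trans te).
have g_c d : D d -> {within `[0, e], continuous (cy \o (f \o arm d))}.
  move=> Dd; apply: (within_continuous_comp (B := setT)); first exact: fa_c.
    by apply: continuous_subspaceT; exact: (l1_cy_continuous (chart_dist XC)).
  by [].
have leg d t : D d -> 0 <= t <= e -> cx v * cy (f (arm d t)) = cx (f (arm d t)) * cy v.
  move=> Dd te; pose C := (f \o arm d) @` `[0, e].
  apply: (connected_leg XC (C := C)).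
  - by apply: connected_continuous_connected (fa_c d Dd); exact: segment_connected.
  - by move=> [s]; rewrite /= in_itv /=; exact: eo.
  - by exists 0; rewrite /= ?arm0 // in_itv /= lexx ltW.
  - by exists t => //; rewrite /= in_itv.
(* On a common leg equal heights mean equal points, and different arms share only the top of the
   triod. *)
have sep d d' s t : D d -> D d' -> d <> d' -> 0 <= s <= e -> 0 <= t <= e ->
    cy (f (arm d s)) = cy (f (arm d' t)) -> s = 0 /\ t = 0.
  move=> Dd Dd' dd' se te E; have [[s0 s1] [t0 t1]] := (andP se, andP te).
  apply: (armI d d') => //; apply: fI'.
  - by apply: armT => //; rewrite s0 (le_trans s1).
  - by apply: armT => //; rewrite t0 (le_trans t1).
  - apply: (l1_inj (chart_dist XC)) => //; apply: (mulIf (lt0r_neq0 v0)).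
    by rewrite -!leg // E.
have e_in : 0 <= e <= e by rewrite lexx ltW.
have z_in : 0 <= (0 : R) <= e by rewrite lexx ltW.
pose g d t := cy (f (arm d t)).
have neq d d' : D d -> D d' -> d <> d' -> g d e <> cy v.
  move=> Dd Dd' dd'; rewrite -f0 -(arm0 d') => /(sep _ _ _ _ Dd Dd' dd' e_in z_in) [e00 _].
  by rewrite e00 ltxx in e0.
have opp_pos d d' : D d -> D d' -> d <> d' -> cy v < g d e -> cy v < g d' e -> False.
  move=> Dd Dd' dd' gd gd'; apply: (@disjoint_arms_opposite R (g d) (g d') e) => //.
  - exact: g_c.
  - exact: g_c.
  - by rewrite /g !arm0.
  - by move=> s t se te /(sep _ _ _ _ Dd Dd' dd' se te)[].
  - by move=> s t se te /(sep _ _ _ _ Dd Dd' dd' se te)[].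
  - by rewrite /g !arm0 f0.
have opp_neg d d' : D d -> D d' -> d <> d' -> g d e < cy v -> g d' e < cy v -> False.
  move=> Dd Dd' dd' gd gd'.
  apply: (@disjoint_arms_opposite R (fun t => - g d t) (fun t => - g d' t) e) => //.
  - by move=> t; apply: cvgN; exact: g_c.
  - by move=> t; apply: cvgN; exact: g_c.
  - by rewrite /g !arm0.
  - by move=> s t se te /oppr_inj/(sep _ _ _ _ Dd Dd' dd' se te)[].
  - by move=> s t se te /oppr_inj/(sep _ _ _ _ Dd Dd' dd' se te)[].
  - by rewrite !ltrN2 /g !arm0 f0.
have D1 : D (1, 0) by left; left.
have D2 : D (-1, 0) by left; right.
have D3 : D (0, 1) by right.
have n12 : (1, 0) <> (-1, 0) :> R * R by case; lra.
have n13 : (1, 0) <> (0, 1) :> R * R by case; lra.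
have n23 : (-1, 0) <> (0, 1) :> R * R by case; lra.
have /eqP := neq _ _ D1 D2 n12; have /eqP := neq _ _ D2 D3 n23.
have /eqP := neq _ _ D3 D1 (fun E => n13 (esym E)).
(* Pigeonhole: of three arms, two end on the same side of the height of [v]. *)
rewrite !neq_lt => /orP[h3|h3] /orP[h2|h2] /orP[h1|h1].
- exact: (opp_neg _ _ D1 D2).
- exact: (opp_neg _ _ D2 D3).
- exact: (opp_neg _ _ D1 D3).
- exact: (opp_pos _ _ D1 D2).
- exact: (opp_neg _ _ D1 D2).
- exact: (opp_pos _ _ D1 D3).
- exact: (opp_pos _ _ D2 D3).
- exact: (opp_pos _ _ D1 D2).
Qed.

Lemma standard_triod_compact : compact (@standard_triod R).
Proof.
apply: compactU; apply: compact_setX; try exact: compact_set1; exact: segment_compact.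
Qed.

(** The triod is mapped linearly on each arm, its left, right and upper ends going to points [p],
    [q], [r] of three different slopes. *)
Lemma ramification_origin : ramification_point (R := R) o.
Proof.
have [p [q [r [pq qr pr]]]] := chart_three XC.
have indep x y a b : cx x * cy y != cx y * cy x ->
    a * cx x = b * cx y -> a * cy x = b * cy y -> a = 0 /\ b = 0.
  move=> xy ex ey; have xy0 : cx x * cy y - cx y * cy x != 0 by rewrite subr_eq0.
  split; apply: (mulIf xy0); rewrite mul0r.
    transitivity (a * cx x * cy y - cx y * (a * cy x)); first by ring.
    by rewrite ex ey; ring.
  transitivity (cx x * (b * cy y) - b * cx y * cy x); first by ring.
  by rewrite -ex -ey; ring.
have pos x y : cx x * cy y != cx y * cy x -> cy x != 0.
  by apply: contra_neq => x0; rewrite (chart_eq0 XC x0) x0 mul0r mulr0.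
pose u (z : R * R) := pos_part (- z.1) * cx p + pos_part z.1 * cx q + z.2 * cx r.
pose v (z : R * R) := pos_part (- z.1) * cy p + pos_part z.1 * cy q + z.2 * cy r.
have fst_c : continuous (fun z : R * R => z.1) by move=> z; exact: cvg_fst.
have snd_c : continuous (fun z : R * R => z.2) by move=> z; exact: cvg_snd.
have l_c : continuous (fun z : R * R => pos_part (- z.1)).
  by apply: pos_part_continuous => z; apply: cvgN; exact: fst_c.
have r_c : continuous (fun z : R * R => pos_part z.1) by exact: pos_part_continuous.
have comb_c a b c : continuous (fun z : R * R => pos_part (- z.1) * a + pos_part z.1 * b + z.2 * c).
  move=> z; apply: cvgD; [apply: cvgD|]; apply: cvgM; try exact: cvg_cst;
    [exact: l_c|exact: r_c|exact: snd_c].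
(* Every triod point is recorded as an arm direction [d], the target [x] of its end, and a parameter
   [s]; injectivity becomes a comparison of nine pairs of arms. *)
have arms z : standard_triod (R := R) z -> exists (d : R * R) (x : X) (s : R),
    [/\ (d = (-1, 0) /\ x = p) \/ (d = (1, 0) /\ x = q) \/ (d = (0, 1) /\ x = r),
        0 <= s <= 1, z = (s * d.1, s * d.2), u z = s * cx x & v z = s * cy x].
  case: z => a b [] [/=]; rewrite in_itv /=.
    move=> /andP[a1 a2] ->; have [a0|/ltW a0] := leP 0 a.
      exists (1, 0), q, a; split; [by right; left|by rewrite a0| by rewrite /= mulr1 mulr0|..];
        by rewrite /u /v /= (pos_part_id a0) pos_part_eq0 ?oppr_le0 // !mul0r addr0 add0r.
    exists (-1, 0), p, (- a); split; [by left| by lra | by rewrite /= mulrN1 opprK mulr0|..];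
      by rewrite /u /v /= (pos_part_eq0 a0) pos_part_id ?oppr_ge0 // !mul0r !addr0.
  move=> -> b01; exists (0, 1), r, b; split => //; [by right; right|by rewrite /= mulr0 mulr1|..];
    by rewrite /u /v /= oppr0 pos_part_id // !mul0r !add0r.
have [f cf fE] : exists2 f : R * R -> X, {within standard_triod (R := R), continuous f} &
    forall z, standard_triod (R := R) z -> cx (f z) = u z /\ cy (f z) = v z.
  apply: (chart_lift XC).
  - by apply: continuous_subspaceT; exact: comb_c.
  - by apply: continuous_subspaceT; exact: comb_c.
  move=> z /arms[d [x [s [_ s01 _ -> ->]]]].
  by have [y [? ?]] := chart_star XC x s01; exists y.
exists (f @` standard_triod (R := R)), f; split.
  apply: (compact_homeomorphism (0, 0)) => //; first exact: metric_hausdorff.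
    exact: standard_triod_compact.
  move=> z z' Tz Tz' E.
  have [[fz fz'] [fw fw']] := (fE _ Tz, fE _ Tz').
  have [d [x [s [dx _ zs uz vz]]]] := arms _ Tz.
  have [d' [x' [s' [dx' _ zs' uz' vz']]]] := arms _ Tz'.
  have ex : s * cx x = s' * cx x' by rewrite -uz -uz' -fz -fw E.
  have ey : s * cy x = s' * cy x' by rewrite -vz -vz' -fz' -fw' E.
  have same y : cy y != 0 -> x = y -> x' = y -> s = s'.
    by move=> y0 xy x'y; move: ey; rewrite xy x'y => /(mulIf y0).
  have diff y y' : cx y * cy y' != cx y' * cy y -> x = y -> x' = y' -> s = 0 /\ s' = 0.
    by move=> yy' xy x'y; move: yy'; rewrite -xy -x'y => /indep; exact.
  rewrite zs zs'.
  have sym y y' : cx y * cy y' != cx y' * cy y -> cx y' * cy y != cx y * cy y'.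
    by rewrite eq_sym.
  case: dx => [[-> xE]|[[-> xE]|[-> xE]]]; case: dx' => [[-> xE']|[[-> xE']|[-> xE']]] /=.
  - by rewrite (same p (pos _ _ pq) xE xE').
  - by have [-> ->] := diff _ _ pq xE xE'; rewrite !mul0r.
  - by have [-> ->] := diff _ _ pr xE xE'; rewrite !mul0r.
  - by have [-> ->] := diff _ _ (sym _ _ pq) xE xE'; rewrite !mul0r.
  - by rewrite (same q (pos _ _ qr) xE xE').
  - by have [-> ->] := diff _ _ qr xE xE'; rewrite !mul0r.
  - by have [-> ->] := diff _ _ (sym _ _ pr) xE xE'; rewrite !mul0r.
  - by have [-> ->] := diff _ _ (sym _ _ qr) xE xE'; rewrite !mul0r.
  - by rewrite (same r (pos _ _ (sym _ _ qr)) xE xE').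
have T0 : standard_triod (R := R) (0, 0).
  by left; split => //=; rewrite in_itv /=; apply/andP; split; lra.
have [fx fy] := fE _ T0.
apply: (l1_inj (chart_dist XC)); rewrite ?fx ?fy /u /v /= oppr0 pos_part_eq0 // !mul0r !addr0.
  by rewrite (chart_cx0 XC).
by rewrite (chart_cy0 XC).
Qed.

Theorem chart_smooth_fan : smooth_fan X.
Proof.
have fX : fan X.
  split; first exact: (chart_dendroid XC).
  by move=> v w /ramification_point_origin-> /ramification_point_origin->.
exists o; split; last exact: (chart_smooth XC).
by split => //; exact: ramification_origin.
Qed.

End StarChartRamification.

(** * Plane sets as metric spaces *)

(** A type of its own, because the notion of fan concerns a whole [metricType]; the metric put on it
    is the l1 one. *)
Definition planar (R : realType) (S : set (R * R)) : Type := {p | p \in S}.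

Section Planar.
Context {R : realType} (S : set (R * R)).

HB.instance Definition _ := Choice.on (planar S).

Definition planar_x (p : planar S) : R := (val p).1.
Definition planar_y (p : planar S) : R := (val p).2.

Let dist (p q : planar S) := `|planar_x p - planar_x q| + `|planar_y p - planar_y q|.

Let distxx p : dist p p = 0.
Proof. by rewrite /dist !subrr normr0 addr0. Qed.

Let dist_positivity p q : dist p q = 0 -> p = q.
Proof.
move/eqP; rewrite paddr_eq0 // !normr_eq0 !subr_eq0 => /andP[/eqP x_eq /eqP y_eq].
by apply: val_inj; apply/eqP; rewrite -pair_eqE; apply/andP; split; apply/eqP.
Qed.

Let dist_sym p q : dist p q = dist q p.
Proof. by rewrite /dist distrC [X in _ + X]distrC. Qed.

Let dist_triangle q p r : dist p r <= dist p q + dist q r.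
Proof. by rewrite /dist addrACA lerD // ler_distD. Qed.

HB.instance Definition _ :=
  isMetric.Build R (planar S) distxx dist_positivity dist_sym dist_triangle.

Lemma planar_dist (p q : planar S) :
  mdist p q = `|planar_x p - planar_x q| + `|planar_y p - planar_y q|.
Proof. by []. Qed.

End Planar.

(** * Topological invariants of legs *)

(** Relative to the top alone, the points linked to [p] form the leg of [p] without the top. *)
Definition linked (T : topologicalType) (N : set T) (x y : T) : Prop :=
  exists C, [/\ connected C, C x, C y & C `<=` ~` N].

(* Purely topological substitutes, in a fan with top [v], for the end points
   and for the limits of end points lying on the leg of [p]. *)
Definition tip (T : topologicalType) (v p : T) : Prop :=
  p <> v /\ forall x y, linked [set v] p x -> linked [set v] p y ->
    x <> p -> y <> p -> linked [set v; p] x y.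

Definition leg_marks (T : topologicalType) (v p : T) : set T :=
  closure (tip v) `&` linked [set v] p.

Definition has_leg_with (T : topologicalType) (v : T) (n : nat) : Prop :=
  exists2 p, p <> v & (leg_marks v p #= `I_n)%card.

Section HomeomorphismTransport.
Variables (T U : topologicalType) (f : T -> U) (g : U -> T).
Hypotheses (cf : continuous f) (cg : continuous g) (fK : cancel f g) (gK : cancel g f).

Lemma linked_homeo N x y : linked N x y -> linked (f @` N) (f x) (f y).
Proof.
move=> [C [cC Cx Cy CN]]; exists (f @` C); split; [|exact: imageP|exact: imageP|].
  by apply: connected_continuous_connected cC _; exact: continuous_subspaceT.
by move=> _ [z Cz <-] [w Nw /(can_inj fK) wz]; apply: (CN z) => //; rewrite -wz.
Qed.

Lemma closure_homeo A x : closure A x -> closure (f @` A) (f x).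
Proof.
move=> clA B /cf /clA[z [Az Bz]]; exists (f z); split => //; exact: imageP.
Qed.

End HomeomorphismTransport.

Section HomeomorphismInvariance.
Variables (T U : topologicalType) (f : T -> U) (g : U -> T).
Hypotheses (cf : continuous f) (cg : continuous g) (fK : cancel f g) (gK : cancel g f).

Lemma linked_homeoE v p x : linked [set f v] (f p) x -> linked [set v] p (g x).
Proof. by move/(linked_homeo cg gK); rewrite fK image_set1 fK. Qed.

Lemma tip_homeo v p : tip v p -> tip (f v) (f p).
Proof.
move=> [pv tp]; split; first by move/(can_inj fK).
move=> x y /linked_homeoE px /linked_homeoE py xp yp.
have g_neq z : z <> f p -> g z <> p by move=> zp gz; apply: zp; rewrite -gz gK.
have := tp _ _ px py (g_neq _ xp) (g_neq _ yp).
by move/(linked_homeo cf fK); rewrite image_setU !image_set1 !gK.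
Qed.

Lemma leg_marks_homeo v p x : leg_marks v p x -> leg_marks (f v) (f p) (f x).
Proof.
move=> [clx lx]; split.
  apply: closureS (closure_homeo cf clx) => _ [z tz <-]; exact: tip_homeo.
by have := linked_homeo cf fK lx; rewrite image_set1.
Qed.

End HomeomorphismInvariance.

Lemma has_leg_with_homeo (T U : topologicalType) (f : T -> U) (g : U -> T) v n :
  continuous f -> continuous g -> cancel f g -> cancel g f ->
  has_leg_with v n -> has_leg_with (f v) n.
Proof.
move=> cf cg fK gK [p pv pn]; exists (f p); first by move/(can_inj fK).
apply: card_eq_trans pn; rewrite (_ : leg_marks _ _ = f @` leg_marks v p).
  by apply: inj_card_eq => x y _ _; exact: (can_inj fK).
apply/seteqP; split => [x mx|_ [x mx <-]]; last exact: (leg_marks_homeo cf cg).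
exists (g x); last exact: gK.
by have := leg_marks_homeo cg cf gK fK mx; rewrite !fK.
Qed.

Lemma homeomorphic_setT (T U : topologicalType) :
  homeomorphic [set: T] [set: U] -> exists (f : T -> U) (g : U -> T),
    [/\ continuous f, continuous g, cancel f g & cancel g f].
Proof.
move=> [f [[fS fI fsurj] cf [g [cg fK]]]]; exists f, g; split.
- exact/continuous_subspace_setT.
- exact/continuous_subspace_setT.
- by move=> x; exact: fK.
- by move=> y; have [x _ <-] := fsurj y I; rewrite fK.
Qed.

(** An injective continuous map embeds the triod since the triod is compact. Homeomorphisms of fans
    therefore match their tops. *)
Lemma ramification_point_homeo (R : realType) (X Y : metricType R) (f : X -> Y) v :
  continuous f -> injective f ->
  ramification_point (R := R) v -> ramification_point (R := R) (f v).
Proof.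
move=> cf fI [S [h [[[hS hI _] ch _] h0]]].
have cfh : {within @standard_triod R, continuous (f \o h)}.
  apply: (within_continuous_comp (B := setT)) ch _ _ => //.
  exact: continuous_subspaceT.
exists ((f \o h) @` @standard_triod R), (f \o h); split; last by rewrite /= h0.
apply: (compact_homeomorphism (0, 0)) => //.
- exact: metric_hausdorff.
- exact: standard_triod_compact.
by move=> p q Tp Tq /fI; apply: hI; exact/mem_set.
Qed.

(** * Links and tips in a chart *)

Section ChartMarks.
Context {R : realType} {X : metricType R} {cx cy : X -> R} {o : X}.
Hypothesis XC : star_chart cx cy o.

Lemma linked_originP p x : p <> o ->
  linked [set o] p x <-> x <> o /\ cx p * cy x = cx x * cy p.
Proof.
move=> po; split=> [[C [cC Cp Cx Co]]|[xo l]].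
  split=> [xo|]; first by apply: (Co x Cx); rewrite xo.
  by apply: (connected_leg XC cC) => // Coo; exact: (Co o Coo).
wlog px : p x po xo l / cy p <= cy x.
  move=> W; have [px|/ltW xp] := leP (cy p) (cy x); first exact: W.
  by have [C [? ? ? ?]] := W x p xo po (esym l) xp; exists C.
exists (leg_span (cx := cx) (cy := cy) p x); split.
- exact: (span_connected XC).
- by split; rewrite // lexx.
- by split; rewrite // px lexx.
move=> z [_ /andP[pz _]] /= zo; have := chart_gt0 XC po.
by rewrite ltNge (le_trans pz) // zo (chart_cy0 XC).
Qed.

Lemma tip_originP p : tip o p <->
  p <> o /\ forall q, q <> o -> cx p * cy q = cx q * cy p -> cy q <= cy p.
Proof.
split=> -[po tp]; split => //.
  move=> q qo l; rewrite leNgt; apply/negP => pq.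
  have p0 := chart_gt0 XC po; have q0 := chart_gt0 XC qo.
  (* The midpoint [x] of the segment to [p] and the higher point [q] lie on opposite sides of [p],
     so a connected set joining them off the origin contains [p]. *)
  have [|x [xx xy]] := chart_star XC p (s := 2^-1).
    by rewrite invr_ge0 ler0n invf_le1 ?ler1n.
  have xo : x <> o by move=> xo; move: xy; rewrite xo (chart_cy0 XC); lra.
  have [||||C [cC Cx Cq Cop]] := tp x q.
  - by apply/(linked_originP _ po); split; [exact: xo|rewrite xx xy; ring].
  - exact/(linked_originP _ po).
  - by move=> xp; move: xy; rewrite xp; lra.
  - by move=> qp; move: pq; rewrite qp ltxx.
  have NCo : ~ C o by move=> /Cop; apply; left.
  have : C p; last by move=> /Cop; apply; right.
  by apply: (span_sub_avoiding XC cC NCo Cx Cq); split => //; rewrite xy; lra.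
move=> x y /linked_originP-/(_ po)[xo px] /linked_originP-/(_ po)[yo py] xp yp.
have p0 := chart_gt0 XC po; have x0 := chart_gt0 XC xo; have y0 := chart_gt0 XC yo.
have below z : z <> o -> z <> p -> cx p * cy z = cx z * cy p -> cy z < cy p.
  move=> zo zp l; rewrite lt_neqAle tp // andbT; apply/eqP => zpE; apply: zp.
  apply: (l1_inj (chart_dist XC)) => //; apply: (mulIf (lt0r_neq0 p0)).
  by rewrite -l zpE.
have xy : cx x * cy y = cx y * cy x.
  apply: (mulIf (lt0r_neq0 p0)); rewrite mulrAC -px.
  by rewrite [RHS]mulrAC -py; ring.
wlog xley : x y xo yo xp yp px py x0 y0 xy / cy x <= cy y.
  move=> W; have [h|/ltW h] := leP (cy x) (cy y); first exact: W.
  by have [C [? ? ? ?]] := W y x yo xo yp xp py px y0 x0 (esym xy) h; exists C.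
exists (leg_span (cx := cx) (cy := cy) x y); split.
- exact: (span_connected XC).
- by split; rewrite // lexx.
- by split; rewrite // xley lexx.
move=> z [_ /andP[xz zy]] /= [zo|zp].
  by move: xz; rewrite zo (chart_cy0 XC) leNgt x0.
by have := below y yo yp py; rewrite ltNge -zp zy.
Qed.

End ChartMarks.

(** * A Cantor set of reals *)

Section TernaryCode.
Variable R : realType.
Implicit Types b : nat -> bool.

Let pw n : R := 3^-1 ^+ n.

Let pw_gt0 n : 0 < pw n.
Proof. by rewrite exprn_gt0 // invr_gt0. Qed.

Let pwS n : pw n = 3 * pw n.+1.
Proof. by rewrite /pw exprS mulrA mulfV ?mul1r. Qed.

(** Base three with digits 0 and 1 only: all digits after a given place together weigh at most half
    a unit of that place. This makes the code injective and leaves gaps between its values. *)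
Definition ternary_sum b n : R := \sum_(k < n) (b k)%:R * 3^-1 ^+ k.
Definition ternary b : R := limn (ternary_sum b).

Let sumS b n : ternary_sum b n.+1 = ternary_sum b n + (b n)%:R * pw n.
Proof. by rewrite /ternary_sum big_ord_recr. Qed.

Lemma eq_ternary_sum b b' n : (forall k, (k < n)%N -> b k = b' k) ->
  ternary_sum b n = ternary_sum b' n.
Proof. by move=> bb'; apply: eq_bigr => k _; rewrite bb'. Qed.

Let sum_bounds b n m :
  ternary_sum b n <= ternary_sum b (n + m) <= ternary_sum b n + 3 / 2 * (pw n - pw (n + m)).
Proof.
elim: m => [|m /andP[lo hi]]; first by rewrite addn0 subrr mulr0 addr0 lexx.
have := pwS (n + m); have := pw_gt0 (n + m).+1.
rewrite addnS sumS; case: (b _); rewrite ?mul1r ?mul0r ?addr0 => ? ?; lra.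
Qed.

Let sum_nd b : nondecreasing_seq (ternary_sum b).
Proof. by move=> n m nm; rewrite -(subnKC nm); case/andP: (sum_bounds b n (m - n)). Qed.

Let sum_cvg b : cvgn (ternary_sum b).
Proof.
apply: nondecreasing_is_cvgn; first exact: sum_nd.
exists (ternary_sum b 0 + 3 / 2 * pw 0) => _ [n _ <-].
by have := sum_bounds b 0 n; have := pw_gt0 (0 + n); rewrite add0n => ? /andP[]; lra.
Qed.

Let code_ge b n : ternary_sum b n <= ternary b.
Proof. exact: nondecreasing_cvgn_le. Qed.

Let code_le b n : ternary b <= ternary_sum b n + 3 / 2 * pw n.
Proof.
apply: limr_le; first exact: sum_cvg.
near=> m; have nm : (n <= m)%N by near: m; exists n.
by have := sum_bounds b n (m - n); have := pw_gt0 m; rewrite subnKC // => ? /andP[]; lra.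
Unshelve. all: by end_near. Qed.

Lemma ternary_close b b' n : (forall k, (k < n)%N -> b k = b' k) ->
  `|ternary b - ternary b'| <= 3 / 2 * 3^-1 ^+ n.
Proof.
move=> /eq_ternary_sum E; have := (code_ge b n, code_le b n, code_ge b' n, code_le b' n).
by rewrite E /pw => -[[[? ?] ?] ?]; rewrite ler_norml; apply/andP; split; lra.
Qed.

Let code_split b b' n : (forall k, (k < n)%N -> b k = b' k) -> b n = false -> b' n = true ->
  ternary b <= ternary_sum b n + pw n / 2 /\ ternary_sum b n + pw n <= ternary b'.
Proof.
move=> /eq_ternary_sum E bn b'n.
have := code_le b n.+1; have := code_ge b' n.+1; have := pwS n.
by rewrite !sumS bn b'n mul0r mul1r -E; split; lra.
Qed.

Let first_difference b b' : b <> b' ->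
  exists2 n, (forall k, (k < n)%N -> b k = b' k) & b n <> b' n.
Proof.
move=> bb'; have ex : exists n, b n != b' n.
  apply: contrapT => /forallNP nex; apply: bb'; apply/funext => n.
  by apply/eqP/negPn/negP; exact: nex.
case: (ex_minnP ex) => n /eqP bn min; exists n => // k kn.
by apply/eqP/negPn/negP => /min; rewrite leqNgt kn.
Qed.

Lemma ternary_inj : injective ternary.
Proof.
move=> b b' E; apply: contrapT => /first_difference[n bb'].
have := pw_gt0 n; case bn : (b n); case b'n : (b' n) => // p0 _.
  have [] := code_split (fun k kn => esym (bb' k kn)) b'n bn; lra.
have [] := code_split bb' bn b'n; lra.
Qed.

Let ternary_mono b b' n : (forall k, (k < n)%N -> b k = b' k) -> ternary b < ternary b' ->
  b n <> b' n -> b n = false /\ b' n = true.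
Proof.
move=> bb' lt; have := pw_gt0 n; case bn : (b n); case b'n : (b' n) => // p0 _.
have [] := code_split (fun k kn => esym (bb' k kn)) b'n bn; lra.
Qed.

Lemma ternary_gap (x y : R) : x < y -> exists2 r, x < r < y & forall b, ternary b <> r.
Proof.
move=> xy; apply: contrapT => nex.
have all_codes r : x < r < y -> exists b, ternary b = r.
  move=> rxy; apply: contrapT => /forallNP nr; apply: nex; by exists r.
have [|b bE] := all_codes ((2 * x + y) / 3); first lra.
have [|b' b'E] := all_codes ((x + 2 * y) / 3); first lra.
have lt : ternary b < ternary b' by lra.
have [|n bb' ne] := @first_difference b b'; first by move=> E; move: lt; rewrite E ltxx.
have [bn b'n] := ternary_mono bb' lt ne.
have [hb hb'] := code_split bb' bn b'n; have p0 := pw_gt0 n.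
(* Codes with the digits of [b] below [n] exceed their common partial sum by at most half of [pw n]
   or by at least [pw n]; three quarters lies between. *)
pose r := ternary_sum b n + 3 / 4 * pw n.
have [|c cE] := all_codes r; first by rewrite /r; lra.
have [|m bc nec] := @first_difference b c.
  by move=> E; move: cE; rewrite -E /r; lra.
(* A code [c] of [r] that leaves [b] before place [n] leaves [b'] at the same place, and would
   exceed the code of [b'], which is above [r]. *)
have [mn|nm] := ltnP m n.
  have ltbc : ternary b < ternary c by rewrite cE /r; lra.
  have [bm cm] := ternary_mono bc ltbc nec.
  have b'c k : (k < m)%N -> b' k = c k by move=> km; rewrite -bb' ?bc // (ltn_trans km).
  have b'm : b' m = false by rewrite -bb'.
  have [h1 h2] := code_split b'c b'm cm; have pm := pw_gt0 m.
  by move: h1 h2; rewrite cE /r; lra.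
have bcn k : (k < n)%N -> b k = c k by move=> kn; apply: bc; exact: leq_trans nm.
case cn : (c n).
  by have [_] := code_split bcn bn cn; rewrite cE /r; lra.
have b'cn k : (k < n)%N -> c k = b' k by move=> kn; rewrite -bcn // bb'.
have [] := code_split b'cn cn b'n.
by rewrite cE -(eq_ternary_sum bcn) /r; lra.
Qed.

End TernaryCode.

(** * Letters and bi-infinite words *)

Notation letter := (one_point_compactification (nat * nat)).
Definition word : Type := prod_topology (fun _ : int => letter).
HB.instance Definition _ := Topological.copy word (prod_topology (fun _ : int => letter)).

Section Letters.

Let pair_open (p : nat * nat) : nbhs p [set p].
Proof.
case: p => n i; exists ([set n], [set i]).
  by split; rewrite nbhs_principalE.
by move=> [m j] [/= -> ->].
Qed.

(** Pairs are isolated, and those with sum below [N] form a finite, hence compact, set whose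
    complement is a neighborhood of [None]. *)
Lemma letter_continuous (Y : topologicalType) (f : letter -> Y) :
  (forall U, nbhs (f None) U ->
    exists N : nat, forall n i : nat, (N <= n + i)%N -> U (f (Some (n, i)))) ->
  continuous f.
Proof.
move=> fN [p|] U fU.
  by apply: filterS (pair_open p) => q qp /=; rewrite (qp : q = p); exact: (nbhs_singleton fU).
have [N NU] := fN _ fU.
pose C := [set p : nat * nat | (p.1 + p.2 < N)%N].
have finC : finite_set C.
  apply: (@sub_finite_set _ _ (`I_N `*` `I_N)); last exact: finite_setX.
  by move=> [n i] /= h; split => /=; apply: leq_ltn_trans h;
    [exact: leq_addr | exact: leq_addl].
exists C.
  split; first exact: finite_compact.
  rewrite -[C]setCK; apply: open_closedC; rewrite openE => p nCp; rewrite /interior.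
  by apply: filterS (pair_open p) => q qp; rewrite (qp : q = p).
move=> _ [[[n i] nC <-]|->]; last exact: (nbhs_singleton fU).
by apply: NU; rewrite leqNgt; exact/negP.
Qed.

Lemma word_compact : compact [set: word].
Proof.
have := @tychonoff int (fun _ => letter) (fun _ => setT)
  (fun _ => one_point_compactification_compact).
by congr compact; apply/seteqP; split.
Qed.

Lemma letter_at_continuous i : continuous (fun w : word => w i).
Proof. exact: proj_continuous. Qed.

Lemma word_cvg (F : set_system word) (w : word) : Filter F ->
  (forall i, (fun v : word => v i) @ F --> w i) -> F --> w.
Proof.
move=> FF Fw; apply/cvg_sup => i; apply/cvg_image.
  by apply/seteqP; split => // a _; exists (fun=> a).
move=> U /Fw; rewrite /= !nbhs_simpl => FU; exists ((fun v : word => v i) @^-1` U) => //.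
apply/seteqP; split => [_ [v + <-] //|a Ua]; by exists (fun=> a).
Qed.

Definition shift (e : int) (w : word) : word := fun i => w (i + e).

Lemma shift_continuous e : continuous (shift e).
Proof.
move=> w; apply: (@word_cvg (shift e @ nbhs w) (shift e w)) => i.
have := @letter_at_continuous (i + e) w.
by apply: cvg_trans.
Qed.

(** Otherwise words outside [U] agreeing with [w] on growing windows would converge to [w]. The
    cylinder itself need not be open, as [None] is not isolated, but transitivity only needs one
    inside each open set. *)
Lemma open_cylinder (U : set word) w : open U -> U w ->
  exists N : nat, forall v : word, (forall i, `|i| <= N%:Z -> v i = w i) -> U v.
Proof.
move=> oU Uw; apply: contrapT => /forallNP nex.
have /choice[u uP] N : exists v : word, (forall i, `|i| <= N%:Z -> v i = w i) /\ ~ U v.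
  by have /existsNP[v /not_implyP[? ?]] := nex N; exists v.
have : u @ \oo --> w.
  apply: word_cvg => i; apply: (cvg_near_cst (w i)).
  exists `|i|%N => // N /= iN; have [uw _] := uP N; apply: uw.
  by rewrite -abszE lez_nat.
move=> /(_ U); rewrite nbhs_simpl => /(_ (open_nbhs_nbhs (conj oU Uw))) [N _ NU].
by have [_] := uP N; apply; apply: NU => /=.
Qed.

End Letters.

Lemma near_continuous (R : realType) (T : topologicalType) (f : T -> R) :
  (forall x e, 0 < e -> \forall y \near x, `|f x - f y| < e) -> continuous f.
Proof. by move=> fe x; apply/cvgrPdist_lt => e e0; exact: fe. Qed.

Lemma mul_continuous (R : realType) (T : topologicalType) (f g : T -> R) :
  continuous f -> continuous g -> continuous (fun x => f x * g x).
Proof. by move=> cf cg x; apply: cvgM; [exact: cf | exact: cg]. Qed.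

Definition constant_word (a : letter) : word := fun=> a.

(** * Heights, rates and slopes *)

Section Coding.
Variables (R : realType) (S : set nat).

(** For [n] in [S] the block consists of the [n + 2] letters with second index from 2 to [n + 3].
    Second indices 0 and 1 are kept out of it, being reserved for nontrivial rates. *)
Definition merge (a : nat * nat) : nat * nat :=
  if (a.1 \in S) && (2 <= a.2 < a.1 + 4)%N then (a.1, 2%N) else a.

Definition letter_class (a : letter) : letter := omap merge a.

(** Tends to the value 1 at [None], and is injective on each block since there the first index is
    fixed. *)
Definition letter_height (a : letter) : R :=
  if a is Some (n, i) then 1 + (n + i).+1%:R^-1 else 1.

(** Over [k < n], the rates of the letters [(k, 0)] telescope to [n + 1] and those of [(k, 1)] to
    its inverse, so products reach all positive rationals; single rates still tend to 1. *)
Definition letter_rate (a : letter) : R :=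
  match a with
  | Some (n, 0) => n.+2%:R / n.+1%:R
  | Some (n, 1) => n.+1%:R / n.+2%:R
  | _ => 1
  end.

Lemma letter_real_continuous (f : letter -> R) (C : R) :
  (forall n i, `|f None - f (Some (n, i))| <= C / (n + i).+1%:R) -> continuous f.
Proof.
move=> fC; apply: letter_continuous => U /nbhs_ballP[e /= e0 eU].
have C0 : 0 <= C by have := fC 0%N 0%N; rewrite divr1; exact: le_trans.
exists (Num.truncn (C / e)).+1 => n i Nni; apply: eU; rewrite /ball /=.
apply: le_lt_trans (fC n i) _; rewrite ltr_pdivrMr // mulrC -ltr_pdivrMr //.
apply: (lt_trans (truncnS_gt _)); rewrite ltr_nat ltnS.
exact: Nni.
Qed.

Lemma letter_height_continuous : continuous letter_height.
Proof.
apply: (@letter_real_continuous _ 1) => n i /=.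
by rewrite opprD addrA subrr sub0r normrN ger0_norm // mul1r.
Qed.

Lemma letter_rate_continuous : continuous letter_rate.
Proof.
apply: (@letter_real_continuous _ 1) => n [|[|i]] /=; last by rewrite subrr normr0 divr_ge0.
- rewrite addn0 -natr1 mulrDl mulfV ?pnatr_eq0 // opprD addrA subrr sub0r.
  by rewrite normrN ger0_norm.
- rewrite addn1 (_ : 1 - _ = 1 / n.+2%:R); last first.
    have n2 : n.+2%:R != 0 :> R by rewrite pnatr_eq0.
    apply: (mulIf n2); rewrite mulrBl !mulfVK // !mul1r.
    by rewrite -[n.+2%:R]natr1 addrC addKr.
  by rewrite ger0_norm ?divr_ge0.
Qed.

Lemma letter_height_bounds a : 1 <= letter_height a <= 2.
Proof.
case: a => [[n i]|] /=; last by rewrite lexx; lra.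
have k1 : 1 <= (n + i).+1%:R :> R by rewrite ler1n.
by rewrite lerDl invr_ge0 ler0n /= -[2]/(1 + 1) lerD2l invf_le1 ?ltr0n.
Qed.

Lemma letter_rate_gt0 a : 0 < letter_rate a.
Proof. by case: a => [[n [|[|i]]]|] /=; rewrite ?divr_gt0. Qed.

Lemma letter_class_rate a a' : letter_class a = letter_class a' ->
  a = a' \/ letter_rate a = 1 /\ letter_rate a' = 1.
Proof.
case: a a' => [[n i]|] [[m j]|] //=; last by left.
move=> [] E; case: i j E => [|[|i]] [|[|j]] //=; rewrite /merge /= ?andbF.
all: try (case: ifP => _).
all: by move=> E; first [by right | left; case: E => *; subst].
Qed.

Lemma letter_pred_near (P : letter -> bool) (w : word) i :
  (exists N : nat, forall m j, (N <= m + j)%N -> P (Some (m, j)) = P None) ->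
  \forall v \near w, P (v i) = P (w i).
Proof.
move=> [N PN]; have cP : continuous P.
  by apply: letter_continuous => U /nbhs_singleton UP; exists N => m j /PN ->.
have := cP (w i) [set P (w i)].
rewrite nbhs_principalE => /(_ (iffRL (principal_filterP _ _) erefl)).
by move=> /(@letter_at_continuous i w).
Qed.

Definition bit_index : countType := (int * int * (nat * nat) + nat * nat)%type.

(* The first kind of bit vanishes on constant words, which the second kind
   then separates up to [letter_class]. *)
Definition word_bit (q : bit_index) (w : word) : bool :=
  match q with
  | inl (i, j, a) => ((w i : option _) == Some a) && ((w j : option _) != Some a)
  | inr a => (letter_class (w 0) : option _) == Some a
  end.

Definition word_bits (w : word) (k : nat) : bool :=
  if unpickle k is Some q then word_bit q w else false.

Definition word_slope (w : word) : R := ternary R (word_bits w).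

Lemma word_bit_near q w : \forall v \near w, word_bit q v = word_bit q w.
Proof.
case: q => [[[i j] a]|a] /=.
  have Pa k : \forall v \near w, ((v k : option _) == Some a) = ((w k : option _) == Some a).
    apply: (@letter_pred_near (fun b => (b : option _) == Some a)).
    exists (a.1 + a.2).+1 => n k' /= h; apply/eqP => -[E].
    by move: h; rewrite -E ltnn.
  near=> v; congr (_ && ~~ _); near: v; exact: Pa.
apply: (@letter_pred_near (fun b => (letter_class b : option _) == Some a)).
(* A letter of class [a] is either [a] itself or has first index [a.1] and second index below
   [a.1 + 4]. *)
exists (a.1 + a.1 + a.2 + 4)%N => n k' /= h; apply/eqP; rewrite /merge /= => -[E].
move: h; rewrite -E; case: ifP => /= [/andP[_ /andP[_ lt]]|_]; lia.
Unshelve. all: by end_near. Qed.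

Lemma word_slope_continuous : continuous word_slope.
Proof.
apply: near_continuous => w e e0.
(* The factor 2/3 cancels the 3/2 of [ternary_close]. *)
have /cvgrPdist_lt/(_ (2 / 3 * e)) : ((3^-1 : R) ^+ n) @[n --> \oo] --> (0 : R).
  by apply: cvg_expr; rewrite ger0_norm ?invr_ge0 // invf_lt1 ?ltr1n.
move=> /(_ ltac:(lra)) [n _ /(_ n (leqnn n))]; rewrite sub0r normrN => ne.
have bits_near : \forall v \near w, forall k, (k < n)%N -> word_bits w k = word_bits v k.
  elim: n {ne} => [|n IH]; first by near=> v => k; rewrite ltn0.
  have wn : \forall v \near w, word_bits w n = word_bits v n.
    rewrite /word_bits; case: unpickle => [q|]; last by near=> v.
    by apply: filterS (word_bit_near q w) => v ->.
  near=> v => k; rewrite ltnS leq_eqVlt => /orP[/eqP->|kn].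
    by near: v.
  by move: k kn; near: v.
apply: filterS bits_near => v vw; apply: le_lt_trans (ternary_close R vw) _.
by move: ne; rewrite ger0_norm ?exprn_ge0 ?invr_ge0 //; lra.
Unshelve. all: by end_near. Qed.

Let word_bit_inj w w' : word_slope w = word_slope w' -> forall q, word_bit q w = word_bit q w'.
Proof.
move=> /ternary_inj E q; have := congr1 (@^~ (pickle q)) E.
by rewrite /word_bits pickleK.
Qed.

(** Once [w] has letter [k] at [i] but not at [j], each of its letters other than [None] shows in a
    bit: the letter [k] by comparison with place [j], any other by comparison with place [i]. *)
Let nonconstant_transfer w w' i j k l m : (forall q, word_bit q w = word_bit q w') ->
  w i = Some k -> w j <> Some k -> w l = Some m -> w' l = Some m.
Proof.
move=> E wi wj wl; have [mk|mk] := eqVneq m k.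
  have := E (inl (l, j, m)); rewrite /= wl eqxx /= mk.
  have -> : (w j : option _) != Some k by apply/eqP.
  by move/esym/andP => [/eqP].
have := E (inl (l, i, m)); rewrite /= wl eqxx /= wi.
have -> : Some k != Some m by apply: contra_neq mk => -[].
by move/esym/andP => [/eqP].
Qed.

Let nonconstantP w : (exists a, w = constant_word a) \/
  exists i j k, w i = Some k /\ w j <> Some k.
Proof.
have [wc|wc] := pselect (forall i, w i = w 0).
  by left; exists (w 0); apply/funext.
right; move/existsNP: wc => [i wi]; case wiE : (w i) => [k|].
  by exists i, 0, k; split => // w0; apply: wi; rewrite w0 wiE.
case w0E : (w 0) => [k|]; last by exfalso; apply: wi; rewrite wiE w0E.
by exists 0, i, k; rewrite wiE.
Qed.

Lemma word_slope_fiber w w' : word_slope w = word_slope w' -> w = w' \/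
  exists a a', [/\ w = constant_word a, w' = constant_word a' & letter_class a = letter_class a'].
Proof.
move/word_bit_inj => E; have E' q := esym (E q).
have [[a wa]|[i [j [k [wi wj]]]]] := nonconstantP w; last first.
  left; apply/funext => l.
  have w'i := nonconstant_transfer E wi wj wi.
  have w'j : w' j <> Some k.
    move=> w'j; have := E (inl (i, j, k)); rewrite /= wi w'i w'j eqxx /=.
    by move/eqP.
  case wl : (w l) => [m|]; first by rewrite (nonconstant_transfer E wi wj wl).
  case w'l : (w' l) => [m|//].
  by rewrite (nonconstant_transfer E' w'i w'j w'l) in wl.
have [[a' wa']|[i [j [k [w'i w'j]]]]] := nonconstantP w'; last first.
  have := E (inl (i, j, k)); rewrite /= w'i wa eqxx andbN => /esym/negbT.
  by rewrite negbK => /eqP.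
right; exists a, a'; split => //.
have cl (b : nat * nat) : ((letter_class a : option _) == Some b) =
    ((letter_class a' : option _) == Some b).
  by have := E (inr b); rewrite /= wa wa'.
case aE : (letter_class a) => [b|].
  by have := cl b; rewrite aE eqxx => /esym/eqP.
case a'E : (letter_class a') => [b|//].
by have := cl b; rewrite aE a'E eqxx.
Qed.

Lemma word_slope_constant a a' : letter_class a = letter_class a' ->
  word_slope (constant_word a) = word_slope (constant_word a').
Proof.
move=> aa'; congr (ternary R _); apply/funext => k; rewrite /word_bits.
by case: unpickle => [[[[i j] b]|b]|] //=; rewrite ?andbN // aa'.
Qed.

End Coding.

(** Makes the maps below total and continuous in a real height ratio, without restriction to the
    unit interval. *)
Definition clamp (R : realType) (t : R) : R := Num.min 1 (pos_part t).

Lemma clamp_bounds (R : realType) (t : R) : 0 <= clamp t <= 1.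
Proof. by rewrite /clamp le_min ge_min ler01 lexx pos_part_ge0. Qed.

Lemma clamp_id (R : realType) (t : R) : 0 <= t <= 1 -> clamp t = t.
Proof. by move=> /andP[t0 t1]; rewrite /clamp (pos_part_id t0) (min_idPr t1). Qed.

Lemma clamp_continuous (R : realType) : continuous (@clamp R).
Proof.
move=> t; apply: (@continuous_min R R (cst 1) (fun u => pos_part u)); first exact: cvg_cst.
have id_c : continuous (@id R) by move=> u; exact: cvg_id.
exact: (pos_part_continuous id_c).
Qed.

(** * The fan of a set of naturals *)

Section LetterFan.
Variables (R : realType) (S : set nat).
Local Notation slope := (word_slope R S).
Local Notation height := (@letter_height R).

Definition fan_point (z : word * R) : R * R :=
  (clamp z.2 * height (z.1 0) * slope z.1, clamp z.2 * height (z.1 0)).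

Definition letter_fan := planar (range fan_point).

HB.instance Definition _ := Metric.copy letter_fan (planar (range fan_point)).

Lemma fan_point_in z : fan_point z \in range fan_point.
Proof. by apply/mem_set; exists z. Qed.

Definition fan_proj (z : word * R) : letter_fan := exist _ (fan_point z) (fan_point_in z).

Definition unit_box : set (word * R) := setT `*` `[0, 1].

Definition fan_origin : letter_fan := fan_proj (constant_word None, 0).

Local Notation cx := (@planar_x R (range fan_point)).
Local Notation cy := (@planar_y R (range fan_point)).

Lemma fan_projx w t : 0 <= t <= 1 -> cx (fan_proj (w, t)) = t * height (w 0) * slope w.
Proof. by move=> t01; rewrite /planar_x /= clamp_id. Qed.

Lemma fan_projy w t : 0 <= t <= 1 -> cy (fan_proj (w, t)) = t * height (w 0).
Proof. by move=> t01; rewrite /planar_y /= clamp_id. Qed.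

Lemma fan_proj_surj p : exists w t, 0 <= t <= 1 /\ fan_proj (w, t) = p.
Proof.
have [[w t] _ pE] := set_mem (valP p).
exists w, (clamp t); split; first exact: clamp_bounds.
by apply: val_inj; rewrite -pE /= /fan_point /= (clamp_id (clamp_bounds t)).
Qed.

Lemma fst_continuous (f : word -> R) : continuous f -> continuous (fun z : word * R => f z.1).
Proof. by move=> cf z U /cf fU; exact: (@cvg_fst _ _ (nbhs z.1) (nbhs z.2) _ _ fU). Qed.

Lemma snd_continuous (f : R -> R) : continuous f -> continuous (fun z : word * R => f z.2).
Proof. by move=> cf z U /cf fU; exact: (@cvg_snd _ _ (nbhs z.1) (nbhs z.2) _ _ fU). Qed.

Lemma word_height_continuous i : continuous (fun w : word => height (w i)).
Proof.
by move=> w U /(@letter_height_continuous R) /(@letter_at_continuous i w).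
Qed.

Lemma fan_proj_continuous : continuous fan_proj.
Proof.
have y_c : continuous (fun z : word * R => clamp z.2 * height (z.1 0)).
  apply: mul_continuous; first exact: (snd_continuous (@clamp_continuous R)).
  exact: (fst_continuous (@word_height_continuous 0)).
apply: (l1_continuous (@planar_dist R (range fan_point))); last exact: y_c.
apply: (mul_continuous y_c).
exact: (fst_continuous (@word_slope_continuous R S)).
Qed.

Lemma unit_box_compact : compact unit_box.
Proof. by apply: compact_setX; [exact: word_compact|exact: segment_compact]. Qed.

Lemma height_gt0 a : 0 < height a.
Proof. by have /andP[h _] := letter_height_bounds R a; exact: lt_le_trans h. Qed.

Lemma letter_class_slope a b : letter_class S a <> letter_class S b ->
  slope (constant_word a) <> slope (constant_word b).
Proof.
move=> ab /word_slope_fiber[/(congr1 (@^~ 0)) E|[a' [b' [/(congr1 (@^~ 0)) E /(congr1 (@^~ 0)) E' E'']]]].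
  by apply: ab; congr letter_class.
by apply: ab; move: E E'; rewrite /constant_word => -> ->.
Qed.

Lemma letter_fan_chart : star_chart cx cy fan_origin.
Proof.
have i0 : 0 <= (0 : R) <= 1 by rewrite lexx ler01.
have i1 : 0 <= (1 : R) <= 1 by rewrite lexx ler01.
split.
- exact: planar_dist.
- rewrite (_ : setT = fan_proj @` unit_box).
    apply: continuous_compact unit_box_compact.
    exact: continuous_subspaceT fan_proj_continuous.
  apply/esym/seteqP; split => // p _; have [w [t [t01 <-]]] := fan_proj_surj p.
  by exists (w, t) => //; split => //=; rewrite in_itv.
- by rewrite fan_projx // !mul0r.
- by rewrite fan_projy // mul0r.
- move=> p; have [w [t [t01 <-]]] := fan_proj_surj p.
  by rewrite fan_projy // mulr_ge0 ?(ltW (height_gt0 _)) //; case/andP: t01.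
- move=> p; have [w [t [t01 <-]]] := fan_proj_surj p.
  by rewrite fan_projy // fan_projx // => ->; rewrite mul0r.
- move=> p s s01; have [w [t [t01 <-]]] := fan_proj_surj p.
  have st01 : 0 <= s * t <= 1.
    have [[s0 s1] [t0 t1]] := (andP s01, andP t01).
    by rewrite mulr_ge0 //= (le_trans (ler_piMl t0 s1)).
  by exists (fan_proj (w, s * t)); rewrite !fan_projx // !fan_projy // !mulrA.
- move=> a b /ternary_gap[r rab rN]; exists r => // p.
  have [w [t [t01 <-]]] := fan_proj_surj p; rewrite fan_projy // fan_projx // => p0.
  apply/eqP; rewrite mulrC => /(mulIf (lt0r_neq0 p0)).
  exact: rN.
pose P a := fan_proj (constant_word a, 1).
have PN a b : letter_class S a <> letter_class S b -> cx (P a) * cy (P b) != cx (P b) * cy (P a).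
  move=> /letter_class_slope ab; rewrite /P !fan_projx // !fan_projy // !mul1r.
  apply/eqP => E; apply: ab; apply: (mulfI (lt0r_neq0 (height_gt0 a))).
  apply: (mulIf (lt0r_neq0 (height_gt0 b))).
  by move: E; rewrite /constant_word => ->; ring.
(* Whatever [S] is, these letters are in no block, so they have three different slopes. *)
exists (P None), (P (Some (0, 0)%N)), (P (Some (0, 1)%N)).
by split; apply: PN; rewrite /= /merge /= ?andbF.
Qed.

End LetterFan.

(** * The action on height ratios *)

Section Mobius.
Variable R : realType.
Implicit Types m n t : R.

(* Multiplication by [m] in the coordinate [t / (1 - t)] on [0, 1]. *)
Definition mobius m t := m * t / (1 - t + m * t).

Lemma mobius_denom_gt0 m t : 0 < m -> 0 <= t <= 1 -> 0 < 1 - t + m * t.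
Proof.
move=> m0 /andP[t0]; rewrite le_eqVlt => /orP[/eqP->|t1].
  by rewrite subrr add0r mulr1.
by rewrite ltr_wpDr ?subr_gt0 // mulr_ge0 // ltW.
Qed.

Lemma mobius_bounds m t : 0 < m -> 0 <= t <= 1 -> 0 <= mobius m t <= 1.
Proof.
move=> m0 t01; have D0 := mobius_denom_gt0 m0 t01; have /andP[t0 t1] := t01.
rewrite divr_ge0 ?mulr_ge0 ?(ltW D0) ?(ltW m0) //= ler_pdivrMr // mul1r.
by rewrite lerDr subr_ge0.
Qed.

Lemma mobius_comp m n t : 0 < m -> 0 < n -> 0 <= t <= 1 ->
  mobius m (mobius n t) = mobius (m * n) t.
Proof.
move=> m0 n0 t01; have /lt0r_neq0 D0 := mobius_denom_gt0 n0 t01.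
have /lt0r_neq0 E0 := mobius_denom_gt0 (mulr_gt0 m0 n0) t01.
by rewrite /mobius; field; rewrite D0 E0.
Qed.

Lemma mobius1 t : mobius 1 t = t.
Proof. by rewrite /mobius !mul1r subrK divr1. Qed.

Lemma mobius0 m : mobius m 0 = 0.
Proof. by rewrite /mobius !mulr0 mul0r. Qed.

Lemma mobius_window t a b : 0 < t < 1 -> 0 <= a < b -> b < 1 ->
  exists x y, 0 <= x < y /\ forall m, x < m < y -> a < mobius m t < b.
Proof.
move=> /andP[t0 t1] /andP[a0 ab] b1.
have t1' : 0 < 1 - t by rewrite subr_gt0.
have a1' : 0 < 1 - a by rewrite subr_gt0 (lt_trans ab).
have b1' : 0 < 1 - b by rewrite subr_gt0.
have ta0 : 0 < t * (1 - a) by exact: mulr_gt0.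
have tb0 : 0 < t * (1 - b) by exact: mulr_gt0.
have x0 : 0 <= a * (1 - t) / (t * (1 - a)).
  by apply: divr_ge0; [apply: mulr_ge0; [|exact: ltW]|exact: ltW].
(* These are the multipliers that send [t] exactly to [a] and to [b]. *)
exists (a * (1 - t) / (t * (1 - a))), (b * (1 - t) / (t * (1 - b))); split.
  rewrite x0 /= ltr_pdivlMr // mulrAC ltr_pdivrMr //.
  rewrite -subr_gt0 [X in 0 < X](_ : _ = (b - a) * ((1 - t) * t)); last by ring.
  by rewrite mulr_gt0 ?subr_gt0 // mulr_gt0 // subr_gt0.
move=> m /andP[xm my]; have m0 : 0 < m by exact: le_lt_trans xm.
have D0 : 0 < 1 - t + m * t by apply: mobius_denom_gt0; rewrite // !ltW.
move: xm my; rewrite ltr_pdivrMr // ltr_pdivlMr // => xm my.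
rewrite /mobius ltr_pdivlMr // ltr_pdivrMr //; apply/andP; split; lra.
Qed.

End Mobius.

(** * Products of rates *)

Section Rates.
Variable R : realType.
Local Notation rate := (@letter_rate R).

Definition rate_product (w : word) (n : nat) : R := \prod_(k < n) rate (w k%:Z).

Lemma rate_productS w n : rate_product w n.+1 = rate (w n%:Z) * rate_product w n.
Proof. by rewrite /rate_product big_ord_recr mulrC. Qed.

Lemma rate_product_gt0 w n : 0 < rate_product w n.
Proof. by apply: prodr_gt0 => k _; exact: letter_rate_gt0. Qed.

Lemma rate_productD w m n :
  rate_product w (m + n) = rate_product w m * rate_product (shift m%:Z w) n.
Proof.
rewrite /rate_product big_split_ord /=; congr (_ * _).
by apply: eq_bigr => k _; rewrite /shift addrC PoszD.
Qed.

Lemma eq_rate_product v w n : (forall k, (k < n)%N -> v k%:Z = w k%:Z) ->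
  rate_product v n = rate_product w n.
Proof. by move=> vw; apply: eq_bigr => k _; rewrite vw. Qed.

Lemma rate_products_dense (x y : R) : 0 <= x < y ->
  exists s : seq letter, x < \prod_(a <- s) rate a < y.
Proof.
move=> /andP[x0 xy].
have up n : \prod_(a <- [seq (Some (k, 0%N) : letter) | k <- iota 0 n]) rate a = n.+1%:R.
  rewrite big_map; elim: n => [|n IH]; first by rewrite big_nil.
  rewrite -addn1 iotaD big_cat IH big_seq1 /= add0n mulrC addn1.
  by rewrite -mulrA mulVf ?mulr1 // pnatr_eq0.
have down n : \prod_(a <- [seq (Some (k, 1%N) : letter) | k <- iota 0 n]) rate a = n.+1%:R^-1.
  rewrite big_map; elim: n => [|n IH]; first by rewrite big_nil invr1.
  rewrite -addn1 iotaD big_cat IH big_seq1 /= add0n addn1.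
  by rewrite mulrA mulVf ?mul1r // pnatr_eq0.
(* The denominator [d + 1] exceeds the inverse of [y - x], and [(n + 1) / (d + 1)] is the first
   multiple of [1 / (d + 1)] beyond [x]. *)
pose d := Num.truncn (y - x)^-1; pose n := Num.truncn (x * d.+1%:R).
exists ([seq Some (k, 0%N) | k <- iota 0 n] ++ [seq Some (k, 1%N) | k <- iota 0 d]).
rewrite big_cat up down.
have d0 : 0 < d.+1%:R :> R by rewrite ltr0n.
have yx0 : 0 < y - x by rewrite subr_gt0.
rewrite ltr_pdivlMr // ltr_pdivrMr // truncnS_gt /=.
have : n%:R <= x * d.+1%:R by rewrite truncn_le mulr_ge0 // ltW.
have : 1 < (y - x) * d.+1%:R by rewrite mulrC -ltr_pdivrMr // div1r truncnS_gt.
rewrite -[n.+1%:R]natr1; lra.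
Qed.

End Rates.

Lemma div_continuous (R : realType) (T : topologicalType) (f g : T -> R) :
  continuous f -> continuous g -> (forall x, g x != 0) -> continuous (fun x => f x / g x).
Proof.
by move=> cf cg g0 x; apply: cvgM; [exact: cf | apply: cvgV; [exact: g0 | exact: cg]].
Qed.

Lemma add_continuous (R : realType) (T : topologicalType) (f g : T -> R) :
  continuous f -> continuous g -> continuous (fun x => f x + g x).
Proof. by move=> cf cg x; apply: cvgD; [exact: cf | exact: cg]. Qed.

Lemma one_sub_continuous (R : realType) (T : topologicalType) (f : T -> R) :
  continuous f -> continuous (fun x => 1 - f x).
Proof. by move=> cf x; apply: cvgB; [exact: cvg_cst | exact: cf]. Qed.

Lemma pair_continuous (T U V : topologicalType) (f : T -> U) (g : T -> V) :
  continuous f -> continuous g -> continuous (fun x => (f x, g x)).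
Proof. by move=> cf cg x; apply: cvg_pair; [exact: cf | exact: cg]. Qed.

Lemma comp_continuous (T U V : topologicalType) (f : T -> U) (g : U -> V) :
  continuous f -> continuous g -> continuous (fun x => g (f x)).
Proof. by move=> cf cg x; apply: continuous_comp; [exact: cf | exact: cg]. Qed.

(** * The homeomorphism *)

Section FanDynamics.
Variables (R : realType) (S : set nat).
Local Notation slope := (word_slope R S).
Local Notation height := (@letter_height R).
Local Notation fan := (letter_fan R S).
Local Notation proj := (@fan_proj R S).

(** Covers the map and its inverse: the inverse shifts back, uses inverse rates, and reads the
    letter at place -1, where the forward shift has moved the letter of place 0. *)
Definition skew (e j : int) (r : letter -> R) (z : word * R) : word * R :=
  (shift e z.1, mobius (r (z.1 j)) (clamp z.2)).

Section Skew.
Variables (e j : int) (r : letter -> R).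
Hypotheses (cr : continuous r) (r0 : forall a, 0 < r a).
Hypothesis r1 : forall a b, letter_class S a = letter_class S b -> a = b \/ r a = 1 /\ r b = 1.

Lemma skew_continuous : continuous (skew e j r).
Proof.
have m_c : continuous (fun z : word * R => r (z.1 j) * clamp z.2).
  apply: mul_continuous; last exact: (snd_continuous (@clamp_continuous R)).
  apply: (fst_continuous (f := fun w => r (w j))).
  exact: (comp_continuous (@letter_at_continuous j) cr).
apply: (pair_continuous (f := fun z : word * R => shift e z.1)).
  exact: (comp_continuous (f := fst) (fun z => @cvg_fst _ _ (nbhs z.1) (nbhs z.2) _)
    (@shift_continuous e)).
apply: (div_continuous m_c).
  apply: (add_continuous _ m_c); apply: one_sub_continuous.
  exact: (snd_continuous (@clamp_continuous R)).
by move=> z; apply/lt0r_neq0/mobius_denom_gt0 => //; exact: clamp_bounds.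
Qed.

Lemma skewE w t : 0 <= t <= 1 -> skew e j r (w, t) = (shift e w, mobius (r (w j)) t).
Proof. by move=> t01; rewrite /skew /= clamp_id. Qed.

Lemma fan_proj_eq w v s t : 0 <= s <= 1 -> 0 <= t <= 1 -> proj (w, s) = proj (v, t) ->
  [\/ s = 0 /\ t = 0, w = v /\ s = t |
      exists a b, [/\ w = constant_word a, v = constant_word b,
                   letter_class S a = letter_class S b & s * height a = t * height b]].
Proof.
move=> s01 t01 E; have := congr1 (@planar_y _ _) E; have := congr1 (@planar_x _ _) E.
rewrite !fan_projx // !fan_projy // => Ex Ey.
have [s0|s0] := eqVneq s 0.
  constructor 1; split => //; move: Ey; rewrite s0 mul0r => /esym/eqP.
  by rewrite mulf_eq0 [height _ == 0]gt_eqF ?height_gt0 // orbF => /eqP.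
have sh0 : s * height (w 0) != 0 by rewrite mulf_neq0 // gt_eqF ?height_gt0.
move: Ex; rewrite -Ey => /(mulfI sh0)/word_slope_fiber[wv|[a [b [wa vb ab]]]].
  constructor 2; split => //; move: Ey; rewrite wv => /mulIf; apply.
  by rewrite gt_eqF ?height_gt0.
by constructor 3; exists a, b; split => //; move: Ey; rewrite wa vb.
Qed.

Lemma skew_compatible z z' : @unit_box R z -> @unit_box R z' -> proj z = proj z' ->
  proj (skew e j r z) = proj (skew e j r z').
Proof.
case: z z' => [w s] [v t] [_ /=] + [_ /=] +; rewrite !in_itv /= => s01 t01 E.
rewrite !skewE //.
have i0 : 0 <= (0 : R) <= 1 by rewrite lexx ler01.
have m01 a u : 0 <= u <= 1 -> 0 <= mobius (r a) u <= 1 by exact: mobius_bounds.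
have [[-> ->]|[-> ->//]|[a [b [-> -> ab h]]]] := fan_proj_eq s01 t01 E.
  apply: (l1_inj (@planar_dist R _)); rewrite !mobius0.
    by rewrite !fan_projx // !mul0r.
  by rewrite !fan_projy // !mul0r.
have rs : mobius (r a) s * height a = mobius (r b) t * height b.
  (* Either the two letters coincide, or both multipliers are 1 and the ratios, though different,
     stay put. *)
  have [ab'|[ra rb]] := r1 ab; last by rewrite ra rb !mobius1.
  have hb : height b != 0 by rewrite gt_eqF ?height_gt0.
  by move: h; rewrite ab' => /(mulIf hb) ->.
apply: (l1_inj (@planar_dist R _)).
  rewrite !fan_projx //; try exact: m01.
  by rewrite /shift /constant_word rs; congr (_ * _); exact: word_slope_constant.
by rewrite !fan_projy //; exact: m01.
Qed.

Lemma skew_factor : exists2 f : fan -> fan, continuous f &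
  forall w t, 0 <= t <= 1 -> f (proj (w, t)) = proj (shift e w, mobius (r (w j)) t).
Proof.
have proj_c : {within @unit_box R, continuous proj}.
  by apply: continuous_subspaceT; exact: fan_proj_continuous.
have proj_s (x : fan) : exists2 z, @unit_box R z & proj z = x.
  have [w [t [t01 <-]]] := fan_proj_surj x.
  by exists (w, t) => //; split => //=; rewrite in_itv.
have G_c : {within @unit_box R, continuous (proj \o skew e j r)}.
  apply: continuous_subspaceT.
  exact: (comp_continuous skew_continuous (@fan_proj_continuous R S)).
have [f cf fE] := compact_quotient_factor (@metric_hausdorff R fan)
  (@unit_box_compact R) proj_c proj_s G_c skew_compatible.
by exists f => // w t t01; rewrite fE /= ?skewE.
Qed.

End Skew.

Lemma rate_inv_continuous : continuous (fun a => (@letter_rate R a)^-1).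
Proof.
by move=> a; exact: (cvgV (lt0r_neq0 (letter_rate_gt0 R a)) (@letter_rate_continuous R a)).
Qed.

Lemma fan_homeomorphism : exists f : fan -> fan, homeomorphism setT setT f /\
  forall w t, 0 <= t <= 1 ->
    f (proj (w, t)) = proj (shift 1 w, mobius (letter_rate R (w 0)) t).
Proof.
have rate0 := @letter_rate_gt0 R.
have [f cf fE] := skew_factor 1 0 (@letter_rate_continuous R) rate0 (@letter_class_rate R S).
have [||g cg gE] := skew_factor (-1) (-1) rate_inv_continuous.
- by move=> a; rewrite invr_gt0.
- by move=> a b /(@letter_class_rate R)[->|[-> ->]]; [left|right; rewrite invr1].
have shiftD d d' w : shift d (shift d' w) = shift (d + d') w.
  by apply/funext => i; rewrite /shift -addrA.
have shift0 w : shift 0 w = w by apply/funext => i; rewrite /shift addr0.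
have gK x : g (f x) = x.
  have [w [t [t01 <-]]] := fan_proj_surj x.
  rewrite fE // gE ?mobius_bounds // shiftD addNr shift0 /shift addNr.
  by rewrite mobius_comp ?invr_gt0 // mulVf ?mobius1 // gt_eqF.
have fK x : f (g x) = x.
  have [w [t [t01 <-]]] := fan_proj_surj x.
  rewrite gE // fE ?mobius_bounds ?invr_gt0 // shiftD subrr shift0 /shift add0r.
  by rewrite mobius_comp ?invr_gt0 // mulfV ?mobius1 // gt_eqF.
exists f; split => //; split.
- split => //; first by move=> x y _ _ /(congr1 g); rewrite !gK.
  by move=> y _; exists (g y).
- exact: continuous_subspaceT.
by exists g; split => //; exact: continuous_subspaceT.
Qed.

End FanDynamics.

(** * Transitivity *)

Section FanTransitivity.
Variables (R : realType) (S : set nat).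
Local Notation fan := (letter_fan R S).
Local Notation proj := (@fan_proj R S).

Lemma open_box (O : set (word * R)) w t : open O -> O (w, t) -> 0 <= t <= 1 ->
  exists (N : nat) (a b : R), 0 <= a < b /\ b <= 1 /\
    forall v s, (forall i, `|i| <= N%:Z -> v i = w i) -> a < s < b -> O (v, s).
Proof.
move=> oO Owt /andP[t0 t1].
have [[A B] /= [Aw /nbhs_ballP[e /= e0 eB]] AB] : nbhs (w, t) O.
  exact: open_nbhs_nbhs.
have [N NA] := open_cylinder (@open_interior _ A) Aw.
exists N, (Num.max 0 (t - e)), (Num.min 1 (t + e)); split; last split.
- rewrite le_max lexx /= gt_max !lt_min ltr01 /=; apply/andP; split; lra.
- by rewrite ge_min lexx.
move=> v s vw /andP[]; rewrite gt_max lt_min => /andP[s0 ts] /andP[s1 st].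
apply: (AB (v, s)); split => /=; first exact: (interior_subset (NA _ vw)).
by apply: eB; rewrite /ball /= ltr_norml; apply/andP; split; lra.
Qed.

Lemma fan_iter (f : fan -> fan) :
  (forall w t, 0 <= t <= 1 -> f (proj (w, t)) = proj (shift 1 w, mobius (letter_rate R (w 0)) t)) ->
  forall n w t, 0 <= t <= 1 ->
    iter n f (proj (w, t)) = proj (shift n%:Z w, mobius (rate_product R w n) t).
Proof.
move=> fE; elim=> [|n IH] w t t01 /=.
  rewrite /rate_product big_ord0 mobius1; congr (proj (_, _)).
  by apply/funext => i; rewrite /shift addr0.
rewrite IH // fE; last exact: (mobius_bounds (rate_product_gt0 _ _ _) t01).
rewrite mobius_comp ?rate_product_gt0 ?letter_rate_gt0 //.
rewrite [shift n%:Z w 0]/shift add0r -rate_productS; congr (proj (_, _)).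
by apply/funext => i; rewrite /shift -addrA -[n.+1]add1n PoszD.
Qed.

Lemma connecting_word (w w' : word) N (x y : R) : 0 <= x < y ->
  exists (u : word) (n : nat), [/\ forall i, `|i| <= N%:Z -> u i = w i,
    forall i, `|i| <= N%:Z -> shift n%:Z u i = w' i & x < rate_product R u n < y].
Proof.
move=> /andP[x0 xy].
(* The contribution of the letters that are imposed: places 0 to [N] of [w] and places [-N] to -1 of
   [w']. The free block [s] corrects it. *)
pose P := rate_product R w N.+1 * rate_product R (shift (- N%:Z) w') N.
have P0 : 0 < P by rewrite mulr_gt0 ?rate_product_gt0.
have [s /andP[xs sy]] : exists s : seq letter, x / P < \prod_(a <- s) letter_rate R a < y / P.
  by apply: rate_products_dense; rewrite divr_ge0 ?(ltW P0) // ltr_pM2r ?invr_gt0.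
pose m := size s; pose n := (N.+1 + m + N)%N.
(* The block fills places [N + 1] to [N + m]. With [n = N + 1 + m + N], the window of [w'] moved by
   [n] starts right after it. *)
pose u : word := fun i => if i <= N%:Z then w i
  else if i < (N.+1 + m)%N%:Z then nth None s (`|i| - N.+1) else w' (i - n%:Z).
exists u, n; split.
- by move=> i iN; rewrite /u; case: ifPn => //; lia.
- move=> i iN; rewrite /shift /u; case: ifPn => [|_]; first by rewrite /n; lia.
  case: ifPn => [|_]; first by rewrite /n; lia.
  by rewrite addrK.
rewrite /n !rate_productD.
have -> : rate_product R u N.+1 = rate_product R w N.+1.
  by apply: eq_rate_product => k kN; rewrite /u; case: ifPn => //; lia.
have -> : rate_product R (shift N.+1 u) m = \prod_(a <- s) letter_rate R a.
  rewrite /rate_product (big_nth None) big_mkord; apply: eq_bigr => k _.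
  congr (letter_rate R _); rewrite /shift /u; case: ifPn => [|_]; first by lia.
  case: ifPn => [_|]; last by have := ltn_ord k; rewrite /m; lia.
  by rewrite -PoszD absz_nat addnK.
have -> : rate_product R (shift (N.+1 + m)%N u) N = rate_product R (shift (- N%:Z) w') N.
  apply: eq_rate_product => k kN; rewrite /shift /u; case: ifPn => [|_]; first by lia.
  case: ifPn => [|_]; first by lia.
  by congr w'; rewrite /n; lia.
move: xs sy; rewrite ltr_pdivrMr // ltr_pdivlMr // /P => xs sy.
by rewrite mulrAC [_ * _ * \prod_(_ <- _) _]mulrC xs.
Qed.

Lemma fan_transitive (f : fan -> fan) :
  (forall w t, 0 <= t <= 1 -> f (proj (w, t)) = proj (shift 1 w, mobius (letter_rate R (w 0)) t)) ->
  transitive_map (R := R) f.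
Proof.
move=> fE U V oU oV [p Up] [q Vq].
have box (A : set fan) r : open A -> A r -> exists w (N : nat) (a b : R),
    0 <= a < b /\ b <= 1 /\
    forall v s, (forall i, `|i| <= N%:Z -> v i = w i) -> a < s < b -> A (proj (v, s)).
  move=> oA Ar; have [w [t [t01 wtr]]] := fan_proj_surj r.
  have oP : open (proj @^-1` A) by move/continuousP: (@fan_proj_continuous R S); exact.
  have [|N [a [b ?]]] := open_box oP _ t01 (w := w); first by rewrite /= wtr.
  by exists w, N, a, b.
have [w [N [a [b [/andP[a0 ab] [b1 wU]]]]]] := box _ _ oU Up.
have [w' [N' [a' [b' [/andP[a'0 ab'] [b'1 wV]]]]]] := box _ _ oV Vq.
pose t := (a + b) / 2; have tab : a < t < b by rewrite /t; apply/andP; split; lra.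
have t01 : 0 < t < 1 by apply/andP; split; lra.
have t01' : 0 <= t <= 1 by apply/andP; split; lra.
(* The target interval is cut at its midpoint because [mobius_window] needs an upper bound below 1,
   while [b'] may be 1. *)
have [||x [y [xy xyP]]] := @mobius_window R t a' ((a' + b') / 2) t01; [lra|lra|].
have [u [n [uw uw' uxy]]] := connecting_word w w' (maxn N N') xy.
exists n, (proj (shift n%:Z u, mobius (rate_product R u n) t)); split.
  exists (proj (u, t)); last exact: fan_iter.
  by apply: wU => // i iN; apply: uw; apply: le_trans iN _; rewrite lez_nat leq_maxl.
apply: wV => [i iN|].
  by apply: uw'; apply: le_trans iN _; rewrite lez_nat leq_maxr.
by have /andP[h1 h2] := xyP _ uxy; apply/andP; split => //; lra.
Qed.

Lemma fan_admits_transitive_homeomorphism :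
  admits_transitive_homeomorphism (R := R) fan.
Proof.
by have [f [hf fE]] := fan_homeomorphism R S; exists f; split => //; exact: fan_transitive.
Qed.

End FanTransitivity.

(** * Counting limits of end points on a leg *)

Section FanMarks.
Variables (R : realType) (S : set nat).
Local Notation slope := (word_slope R S).
Local Notation height := (@letter_height R).
Local Notation proj := (@fan_proj R S).
Local Notation o := (fan_origin R S).
Local Notation cx := (@planar_x R (range (@fan_point R S))).
Local Notation cy := (@planar_y R (range (@fan_point R S))).

Let XC := letter_fan_chart R S.

Let i1 : 0 <= (1 : R) <= 1.
Proof. by rewrite lexx ler01. Qed.

Lemma fan_proj_origin w t : 0 <= t <= 1 -> proj (w, t) <> o -> 0 < t.
Proof.
move=> /[dup] t01 /andP[t0 _] wo; rewrite lt_neqAle t0 andbT.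
apply/eqP => t00; apply: wo; apply: (chart_oP XC).
by rewrite fan_projy // -t00 mul0r.
Qed.

Lemma fan_proj1_neq w : proj (w, 1) <> o.
Proof.
move=> /(congr1 cy); rewrite (chart_cy0 XC) fan_projy // mul1r.
by apply/eqP; rewrite gt_eqF ?height_gt0.
Qed.

Lemma fan_proj_collinear w v s t : 0 <= s <= 1 -> 0 <= t <= 1 -> 0 < s -> 0 < t ->
  cx (proj (w, s)) * cy (proj (v, t)) = cx (proj (v, t)) * cy (proj (w, s)) <->
  slope w = slope v.
Proof.
move=> s01 t01 s0 t0; rewrite !fan_projx // !fan_projy //; split=> [E|->]; last by ring.
have d0 : s * height (w 0) * (t * height (v 0)) != 0.
  by rewrite !mulf_neq0 // gt_eqF ?height_gt0.
by apply: (mulfI d0); move: E => E; ring: E.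
Qed.

Lemma nonconstant_tip w : (forall a, w <> constant_word a) -> tip o (proj (w, 1)).
Proof.
move=> wN; apply/(tip_originP XC); split; first exact: fan_proj1_neq.
move=> q qo; have [v [t [t01 qE]]] := fan_proj_surj q.
have t0 : 0 < t by apply: (@fan_proj_origin v) => //; rewrite qE.
rewrite -qE => /fan_proj_collinear-/(_ i1 t01 ltr01 t0) /word_slope_fiber[<-|[a [b [/wN//]]]].
rewrite !fan_projy // ler_pM2r ?height_gt0 //; by case/andP: t01.
Qed.

Lemma tip_top p : tip o p -> exists w, p = proj (w, 1).
Proof.
move=> /(tip_originP XC)[po tp]; have [w [t [t01 pE]]] := fan_proj_surj p.
have t0 : 0 < t by apply: (@fan_proj_origin w) => //; rewrite pE.
exists w; rewrite -pE; congr (proj (_, _)).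
have := tp (proj (w, 1)) (@fan_proj1_neq w).
rewrite -pE => /(_ (iffRL (fan_proj_collinear w w t01 i1 t0 ltr01) erefl)).
rewrite !fan_projy // ler_pM2r ?height_gt0 // => t1.
by apply/eqP; rewrite eq_le t1 andbT; case/andP: t01.
Qed.

(** Tips are leg tops, which form a compact set. Conversely the top of a nonconstant word is a tip,
    and a constant word is approximated by words agreeing with it on a large window only. *)
Lemma closure_tips p : closure (tip o) p <-> exists w, p = proj (w, 1).
Proof.
have top_c : continuous (fun w : word => proj (w, 1)).
  have id_c : continuous (@id word) by move=> w; exact: cvg_id.
  exact: (comp_continuous (pair_continuous id_c (@cst_continuous word R 1)) (@fan_proj_continuous R S)).
split=> [clp|[w ->]].
  have clM : closed [set proj (w, 1) | w in [set: word]].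
    apply: compact_closed; first exact: metric_hausdorff.
    by apply: continuous_compact word_compact; exact: continuous_subspaceT.
  have [w _ <-] : [set proj (w, 1) | w in [set: word]] p.
    move/closure_id: clM => ->; apply: closureS clp => q /tip_top[w ->].
    by exists w.
  by exists w.
have [[a wa]|wN] := pselect (exists a, w = constant_word a); last first.
  by apply: subset_closure; apply: nonconstant_tip => a wa; apply: wN; exists a.
move=> B Bw.
have oB : open ((fun w : word => proj (w, 1)) @^-1` B°).
  by move/continuousP: top_c; apply; exact: open_interior.
have [N NB] := open_cylinder oB Bw.
(* Any letter other than [a]; it makes [v] nonconstant outside the window. *)
pose a' : letter := if a is None then Some (0, 0)%N else None.
pose v : word := fun i => if `|i| <= N%:Z then a else a'.
exists (proj (v, 1)); split; last first.
  by apply: interior_subset; apply: (NB v) => i iN; rewrite /v iN wa.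
apply: nonconstant_tip => b vb.
have v0 : v 0 = a by rewrite /v normr0.
have vN : v N.+1%:Z = a' by rewrite /v ifN // -ltNge; lia.
by move: v0 vN; rewrite vb /constant_word => ->; rewrite /a'; case: (a).
Qed.

Definition letter_fibre (a : letter) : set letter :=
  [set b | letter_class S b = letter_class S a].

Lemma leg_marksE w t : 0 <= t <= 1 -> 0 < t ->
  leg_marks o (proj (w, t)) = [set proj (v, 1) | v in [set v | slope v = slope w]].
Proof.
move=> t01 t0.
have po : proj (w, t) <> o.
  move=> /(congr1 cy); rewrite (chart_cy0 XC) fan_projy //.
  by apply/eqP; rewrite mulf_neq0 // gt_eqF ?height_gt0.
apply/seteqP; split => [p [/closure_tips[v ->] /(linked_originP XC _ po)[_ l]]|_ [v vw <-]].
  by exists v => //; move: l => /fan_proj_collinear -/(_ t01 i1 t0 ltr01) ->.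
split; first by apply/closure_tips; exists v.
apply/(linked_originP XC _ po); split; first exact: fan_proj1_neq.
by apply/fan_proj_collinear.
Qed.

(** Merging preserves the first index and the height determines the sum of both indices. *)
Lemma letter_height_fibre_inj a b : letter_class S a = letter_class S b ->
  height a = height b -> a = b.
Proof.
case: a b => [[n i]|] [[m j]|] //= [E] /addrI /invr_inj /eqP.
rewrite eqr_nat eqSS => /eqP nm.
move: E; rewrite /merge /=; case: ifP => _; case: ifP => _ [] *; subst => //.
all: by congr (Some (_, _)); lia.
Qed.

Lemma leg_marks_constant a :
  (leg_marks o (proj (constant_word a, 1)) #= letter_fibre a)%card.
Proof.
rewrite leg_marksE //.
rewrite (_ : image _ _ = (fun b => proj (constant_word b, 1)) @` letter_fibre a).
  apply: inj_card_eq => b c /set_mem bE /set_mem cE /(congr1 cy).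
  rewrite !fan_projy // !mul1r; apply: letter_height_fibre_inj.
  by rewrite (bE : _ = _) (cE : _ = _).
apply/seteqP; split => [_ [v /= va <-]|_ [b bE <-]]; last first.
  by exists (constant_word b) => //; exact: word_slope_constant.
have [->|[b [c [-> + bc]]]] := word_slope_fiber va; first by exists a.
move=> /(congr1 (@^~ 0)); rewrite /constant_word => ac.
by exists b => //; rewrite /letter_fibre /= bc ac.
Qed.

Lemma leg_marks_nonconstant w t : 0 <= t <= 1 -> 0 < t ->
  (forall a, w <> constant_word a) -> (leg_marks o (proj (w, t)) #= `I_1)%card.
Proof.
move=> t01 t0 wN; rewrite leg_marksE //.
rewrite (_ : image _ _ = [set proj (w, 1)]); first exact: card_set1.
apply/seteqP; split => [_ [v /= vw <-]|_ ->]; last by exists w.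
by have [->//|[b [c [_ /wN]]]] := word_slope_fiber vw.
Qed.

Lemma merge2 n : merge S (n, 2%N) = (n, 2%N).
Proof. by rewrite /merge; case: ifP. Qed.

Lemma merged_fibre n : S n -> (letter_fibre (Some (n, 2%N)) #= `I_n.+2)%card.
Proof.
move=> Sn; have nS : n \in S by exact: mem_set.
rewrite (_ : letter_fibre _ = (fun k => Some (n, k.+2)) @` `I_n.+2).
  by apply: inj_card_eq => k l _ _ [].
apply/seteqP; split => [[[m i]|] //|_ [k kn <-]]; rewrite /letter_fibre /= merge2 /merge /=.
  case: ifP => [/andP[_ /andP[i2 im]] [mn]|_ [-> ->]]; last by exists 0%N.
  exists (i - 2)%N => /=; first by lia.
  by congr (Some (_, _)); lia.
by rewrite nS /= ifT //; move: kn => /=; lia.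
Qed.

Lemma letter_fibre_card a : (letter_fibre a #= `I_1)%card \/
  exists2 n, S n & (letter_fibre a #= `I_n.+2)%card.
Proof.
case: a => [[n i]|]; last first.
  left; rewrite (_ : letter_fibre _ = [set None]); first exact: card_set1.
  by apply/seteqP; split => [[[m j]|]|_ ->].
have [/andP[nS i2]|niN] := boolP ((n \in S) && (2 <= i < n + 4)%N).
  right; exists n; first exact: set_mem.
  rewrite (_ : letter_fibre _ = letter_fibre (Some (n, 2%N))).
    by apply: merged_fibre; exact: set_mem.
  by rewrite /letter_fibre /= merge2 [merge S (n, i)]/merge /= nS i2.
left; rewrite (_ : letter_fibre _ = [set Some (n, i)]); first exact: card_set1.
apply/seteqP; split => [[[m j]|] //|_ -> //].
rewrite /letter_fibre /= /merge /= (negbTE niN).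
case: ifP => [/andP[mS j2] [mn i2]|_ [-> ->] //].
by move: niN; rewrite -mn -i2 mS /=; lia.
Qed.

(** Legs of nonconstant words and of unglued letters carry one mark, so a count of at least 2 can
    only come from a block, whose size gives back [n]. *)
Lemma has_leg_withE n : has_leg_with o n.+2 <-> S n.
Proof.
split=> [[p po pn]|Sn]; last first.
  exists (proj (constant_word (Some (n, 2%N)), 1)); first exact: fan_proj1_neq.
  exact: card_eq_trans (leg_marks_constant _) (merged_fibre Sn).
have [w [t [t01 pE]]] := fan_proj_surj p.
have t0 : 0 < t by apply: (@fan_proj_origin w) => //; rewrite pE.
have np : (`I_n.+2 #= leg_marks o p)%card by rewrite card_eq_sym.
have [[a wa]|wN] := pselect (exists a, w = constant_word a); last first.
  have := leg_marks_nonconstant t01 t0 (fun a wa => wN (ex_intro _ a wa)).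
  by rewrite pE => h; have /card_eq_II := card_eq_trans np h.
have h := leg_marks_constant a.
have pE' : leg_marks o (proj (constant_word a, 1)) = leg_marks o p.
  by rewrite -pE leg_marksE // leg_marksE // wa.
rewrite pE' in h.
have [h1|[m Sm h1]] := letter_fibre_card a.
  by have /card_eq_II := card_eq_trans np (card_eq_trans h h1).
by have /card_eq_II [->] := card_eq_trans np (card_eq_trans h h1).
Qed.

End FanMarks.

(** * The uncountable family *)

Lemma set_nat_uncountable : ~ countable [set: set nat].
Proof.
move=> /countable_injP[f fI].
pose D := [set n | exists2 A, f A = n & ~ A n].
have [DD|ND] := pselect (D (f D)); last by apply: (ND); exists D.
have [A fA NA] := DD; apply: NA.
by rewrite (fI A D (mem_setT _) (mem_setT _) fA).
Qed.

Theorem theorem4p56 (R : realType) :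
  exists (I : Type) (F : I -> metricType R),
    [/\ ~ countable [set: I],
        forall i j : I, i <> j -> ~ homeomorphic [set: F i] [set: F j] &
        forall i : I, smooth_fan (F i) /\ admits_transitive_homeomorphism (F i)].
Proof.
exists (set nat), (@letter_fan R); split; first exact: set_nat_uncountable.
- move=> S S' SS' /homeomorphic_setT[f [g [cf cg fK gK]]]; apply: SS'.
  have legs (T T' : set nat) (h : letter_fan R T -> letter_fan R T')
      (k : letter_fan R T' -> letter_fan R T) :
      continuous h -> continuous k -> cancel h k -> cancel k h -> T `<=` T'.
    move=> ch ck hK kK n /(has_leg_withE R) /(has_leg_with_homeo ch ck hK kK).
    (* Leg counts refer to the top, which a homeomorphism preserves because it is the only
       ramification point. *)
    suff -> : h (fan_origin R T) = fan_origin R T' by move/(has_leg_withE R).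
    apply: (ramification_point_origin (letter_fan_chart R T')).
    apply: ramification_point_homeo ch (can_inj hK) _.
    exact: (ramification_origin (letter_fan_chart R T)).
  by apply/seteqP; split; [exact: (legs _ _ f g)|exact: (legs _ _ g f)].
move=> S; split; first exact: (chart_smooth_fan (letter_fan_chart R S)).
exact: fan_admits_transitive_homeomorphism.
Qed.
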